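(* Let $q$ be a prime power, $F$ a field of characteristic $p>0$ not dividing $q$, and $m=m(p,q)$. Let $(k,i)$ be a middle index for $n$. Then the Brauer character of $G_n=\mathrm{GL}(n,q)$ on $H^n_{k,i}$ is $$\chi(g,H^n_{k,i})=\sum_{t\in\mathbb{Z}}\bigl(\pi_{k+tm}(g)-\pi_{k-i+tm}(g)\bigr)$$ for all $p$-regular $g\in G_n$, where $\pi_j(g)$ denotes the number of $j$-dimensional subspaces of $\mathbb{F}_q^n$ stabilized by $g$ (so $\pi_j=0$ if $j<0$ or $j>n$).
   Context: For $i\ge 1$ put $[i]_q=1+q+\dots+q^{i-1}$, and let $m=m(p,q):=\min\{i>1 : [i]_q=0 \text{ in } F\}$. For integers $n\ge 0$ and $k$ let $L^n_k$ be the set of $k$-dimensional subspaces of $\mathbb{F}_q^n$ and let $M^n_k=FL^n_k$ be the $F$-vector space with basis $L^n_k$ ($M^n_k=0$ if $k<0$ or $k>n$). The incidence map $\partial:M^n_k\to M^n_{k-1}$ is the linear map sending $x\in L^n_k$ to the sum of all $(k-1)$-dimensional subspaces of $x$. One has $\partial^m=0$. The group $G_n=\mathrm{GL}(n,q)$ acts on $M^n_k$ by permuting subspaces, commuting with $\partial$. For $0<i<m$ the incidence homology is the $FG_n$-module $$H^n_{k,i}:=(\ker\partial^i\cap M^n_k)\,/\,\partial^{m-i}(M^n_{k+m-i}).$$ A pair of integers $(k,i)$ is a middle index for $n$ if $0\le k\le n$, $0<i<m$ and $n<2k+m-i<n+m$. *)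

(* Defs.v *)
From HB Require Import structures.
From mathcomp Require Import all_boot all_order all_algebra.
From mathcomp Require Import fingroup pgroup algC mxrepresentation.

Set Implicit Arguments.
Unset Strict Implicit.
Unset Printing Implicit Defensive.

Import Order.TTheory GRing.Theory Num.Theory.
Local Open Scope ring_scope.

Section QuantumCharacteristic.

Variables (F : fieldType) (q : nat).

Definition qint (i : nat) : F := \sum_(j < i) q%:R ^+ j.

Definition is_quantum_char (m : nat) : Prop :=
  [/\ (1 < m)%N, qint m = 0
    & forall i : nat, (1 < i)%N -> qint i = 0 -> (m <= i)%N].

End QuantumCharacteristic.

(* MathComp's {'GL_n[R]} is made of matrices of size n.-1.+1, so that its     *)
(* instance at n = 0 is GL(1); GLn below is the trivial group when n = 0.     *)
Section GeneralLinear.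

Variables (R : finFieldType) (n : nat).

Record GLn : Type :=
  GLnElt { GLn_val :> 'M[R]_n; GLn_valP : GLn_val \in unitmx }.

HB.instance Definition _ := [isSub for GLn_val].
HB.instance Definition _ := [Equality of GLn by <:].
HB.instance Definition _ := [Choice of GLn by <:].
HB.instance Definition _ := [Countable of GLn by <:].
HB.instance Definition _ := [Finite of GLn by <:].

Implicit Types g h : GLn.

Fact GLn_mul_subproof g h : val g *m val h \in unitmx.
Proof. by rewrite unitmx_mul (valP g) (valP h). Qed.

Fact GLn_inv_subproof g : invmx (val g) \in unitmx.
Proof. by rewrite unitmx_inv (valP g). Qed.

Definition GLn_one : GLn := Sub 1%:M (unitmx1 R n).
Definition GLn_mul g h : GLn := Sub (val g *m val h) (GLn_mul_subproof g h).
Definition GLn_inv g : GLn := Sub (invmx (val g)) (GLn_inv_subproof g).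

Fact GLn_mulA : associative GLn_mul.
Proof. by move=> g h k; apply/val_inj; rewrite /= mulmxA. Qed.

Fact GLn_mul1 : left_id GLn_one GLn_mul.
Proof. by move=> g; apply/val_inj; rewrite /= mul1mx. Qed.

Fact GLn_mulV : left_inverse GLn_one GLn_inv GLn_mul.
Proof. by move=> g; apply/val_inj; rewrite /= mulVmx ?(valP g). Qed.

HB.instance Definition _ :=
  Finite_isGroup.Build GLn GLn_mulA GLn_mul1 GLn_mulV.

Lemma val_GLn1 : val (1%g : GLn) = 1%:M. Proof. by []. Qed.
Lemma val_GLnM g h : val (g * h)%g = val g *m val h. Proof. by []. Qed.

End GeneralLinear.

(* Vectors of R^n are rows, and a matrix g acts by u |-> u *m g.              *)
Section Subspaces.

Variables (R : finFieldType) (n : nat).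

Definition subspace : Type := {vspace 'rV[R]_n}.

HB.instance Definition _ := SubChoice.on subspace.
HB.instance Definition _ := [Finite of subspace by <:].

Definition GLn_lfun (g : GLn R n) : 'End('rV[R]_n) := linfun (mulmxr (val g)).

Definition subspace_act (x : subspace) (g : GLn R n) : subspace :=
  (GLn_lfun g @: x)%VS.

Lemma subspace_act1 x : subspace_act x 1%g = x.
Proof.
suff /lfunP E: GLn_lfun 1%g =1 \1%VF.
  by rewrite /subspace_act E; apply: lim1g.
by move=> u; rewrite lfunE id_lfunE /= mulmx1.
Qed.

Lemma subspace_actM x g h :
  subspace_act x (g * h)%g = subspace_act (subspace_act x g) h.
Proof.
rewrite /subspace_act -limg_comp; congr (_ @: _)%VS.
by apply/lfunP=> u; rewrite comp_lfunE !lfunE /= mulmxA.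
Qed.

Definition num_stable (j : int) (g : GLn R n) : nat :=
  #|[set x : subspace | ((\dim x)%:Z == j) && (subspace_act x g == x)]|.

End Subspaces.

(* The graded module M^n = (+)_k M^n_k is the space of row vectors indexed by *)
(* all the subspaces of R^n; the incidence map is an endomorphism of M^n and  *)
(* M^n_k is one of its subspaces, so that incidence_mx ^+ i restricts to the  *)
(* map from M^n_k to M^n_(k - i).                                             *)
Section IncidenceHomology.

Variables (F : fieldType) (R : finFieldType) (n : nat).

Local Notation T := (subspace R n).
Local Notation N := #|{: T}|.
Local Notation G := [set: GLn R n]%G.

Definition subspace_vec (x : T) : 'rV[F]_N := delta_mx 0 (enum_rank x).

Definition incidence_mx : 'M[F]_N :=
  \matrix_i (let x : T := enum_val i in
    \sum_(y : T | (y <= x)%VS && ((\dim y).+1 == \dim x)) subspace_vec y).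

Definition degree_mx (k : int) : 'M[F]_N :=
  (\sum_(x : T | (\dim x)%:Z == k) <<subspace_vec x>>)%MS.

Definition subspace_perm_mx (g : GLn R n) : 'M[F]_N :=
  \matrix_i subspace_vec (subspace_act (enum_val i) g).

Lemma subspace_vec_perm x g :
  subspace_vec x *m subspace_perm_mx g = subspace_vec (subspace_act x g).
Proof. by rewrite -rowE rowK enum_rankK. Qed.

Lemma subspace_vec_incidence x :
  subspace_vec x *m incidence_mx =
  \sum_(y : T | (y <= x)%VS && ((\dim y).+1 == \dim x)) subspace_vec y.
Proof. by rewrite -rowE rowK enum_rankK. Qed.

Fact subspace_perm_mx_repr : mx_repr G subspace_perm_mx.
Proof.
have E A B : (forall x, subspace_vec x *m A = subspace_vec x *m B) -> A = B.
  move=> eqAB; apply/row_matrixP=> i; rewrite !rowE.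
  by have := eqAB (enum_val i); rewrite /subspace_vec enum_valK.
split=> [|g h _ _]; apply: E => x.
  by rewrite subspace_vec_perm subspace_act1 mulmx1.
by rewrite mulmxA !subspace_vec_perm subspace_actM.
Qed.

Definition subspace_repr : mx_representation F G N := MxRepresentation subspace_perm_mx_repr.

Lemma GLn_lfun_inj (g : GLn R n) : lker (GLn_lfun g) == 0%VS.
Proof.
apply/lker0P=> u v; rewrite !lfunE /= => /(congr1 (mulmx^~ (invmx (val g)))).
by rewrite !mulmxK ?(valP g).
Qed.

Lemma dim_subspace_act (x : T) g : \dim (subspace_act x g) = \dim x.
Proof. by rewrite limg_dim_eq // (eqP (GLn_lfun_inj g)) capv0. Qed.

Lemma subspace_actS (x y : T) g :
  (subspace_act y g <= subspace_act x g)%VS = (y <= x)%VS.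
Proof. exact: limg_ker0 (GLn_lfun_inj g). Qed.

Lemma subspace_act_bij g : bijective ((@subspace_act R n)^~ g).
Proof.
by exists ((@subspace_act R n)^~ g^-1%g) => x;
  rewrite -subspace_actM ?mulgV ?mulVg subspace_act1.
Qed.

Lemma incidence_perm g :
  incidence_mx *m subspace_perm_mx g = subspace_perm_mx g *m incidence_mx.
Proof.
apply/row_matrixP=> i; rewrite !rowE -(enum_valK i) -/(subspace_vec _).
set x := enum_val i; rewrite !mulmxA subspace_vec_perm !subspace_vec_incidence.
rewrite mulmx_suml [RHS](reindex_inj (bij_inj (subspace_act_bij g))) /=.
apply: eq_big => [y|y _]; last by rewrite subspace_vec_perm.
by rewrite subspace_actS !dim_subspace_act.
Qed.

Lemma incidenceX_perm i g :
  incidence_mx ^+ i *m subspace_perm_mx g = subspace_perm_mx g *m incidence_mx ^+ i.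
Proof.
elim: i => [|i IHi]; first by rewrite expr0 mul1mx mulmx1.
by rewrite exprS -mulmxE -mulmxA IHi !mulmxA incidence_perm.
Qed.

Fact degree_module k : mxmodule subspace_repr (degree_mx k).
Proof.
apply/mxmoduleP=> g _; rewrite /degree_mx sumsmxMr_gen.
apply/sumsmx_subP=> x /eqP dimx; rewrite genmxE.
rewrite (eqmxMr _ (genmxE _)) subspace_vec_perm.
by rewrite (sumsmx_sup (subspace_act x g)) ?genmxE // dim_subspace_act dimx.
Qed.

Definition cycles_mx (k : int) (i : nat) : 'M[F]_N :=
  (kermx (incidence_mx ^+ i) :&: degree_mx k)%MS.

Definition boundaries_mx (m : nat) (k : int) (i : nat) : 'M[F]_N :=
  degree_mx (k + m%:Z - i%:Z) *m incidence_mx ^+ (m - i)%N.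

Fact cycles_module k i : mxmodule subspace_repr (cycles_mx k i).
Proof.
apply: capmx_module (degree_module k); apply/mxmoduleP=> g _.
by apply/sub_kermxP; rewrite -mulmxA -incidenceX_perm mulmxA mulmx_ker mul0mx.
Qed.

Fact boundaries_module m k i : mxmodule subspace_repr (boundaries_mx m k i).
Proof.
apply/mxmoduleP=> g Gg; rewrite -mulmxA incidenceX_perm mulmxA submxMr //.
by have /mxmoduleP := degree_module (k + m%:Z - i%:Z); apply.
Qed.

(* The quotient cycles / boundaries: section_repr takes the denominator first *)
(* and yields (denominator + numerator) / denominator; boundaries are cycles  *)
(* because the m-th power of the incidence map vanishes when m is the quantum *)
(* characteristic.                                                            *)
Definition incidence_homology_repr (m : nat) (k : int) (i : nat) :=
  section_repr (boundaries_module m k i) (cycles_module k i).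

End IncidenceHomology.

Section BrauerCharacter.

Variable p : nat.

Definition preg_root1 (K : fieldType) (z : K) : Prop :=
  exists2 r : nat, p^'.-nat r & r.-unity_root z.

(* theta restricts to a group isomorphism from the roots of unity of order    *)
(* prime to p of K to those of algC; its other values are irrelevant.         *)
Definition brauer_lift (K : fieldType) (theta : K -> algC) : Prop :=
  [/\ forall z, preg_root1 z -> preg_root1 (theta z),
      forall z w, preg_root1 z -> preg_root1 w ->
        theta (z * w) = theta z * theta w,
      forall z w, preg_root1 z -> preg_root1 w -> theta z = theta w -> z = w
    & forall y, preg_root1 y -> exists2 z, preg_root1 z & theta z = y].

(* iota embeds F in an algebraically closed field K; the sum is over the      *)
(* eigenvalues of g in K, with multiplicity.                                  *)
Definition brauer_char (F : fieldType) (K : closedFieldType)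
    (iota : {rmorphism F -> K}) (theta : K -> algC)
    (gT : finGroupType) (G : {group gT}) (d : nat)
    (rG : mx_representation F G d) (g : gT) : algC :=
  \sum_(z <- sval (closed_field_poly_normal
                     (char_poly (map_mx iota (rG g))))) theta z.

End BrauerCharacter.

Definition middle_index (n m : nat) (k : int) (i : nat) : Prop :=
  [/\ 0 <= k <= n%:Z, (0 < i < m)%N
    & n%:Z < k *+ 2 + m%:Z - i%:Z < n%:Z + m%:Z].

(* Main.v *)
(* The sequence of the maps d^i and d^(m-i) between the M^n_(k+tm) and the    *)
(* M^n_(k-i+tm) is a complex whose only homology is H^n_(k,i), so additivity  *)
(* of Brauer characters gives the alternating sum of the characters of the    *)
(* permutation modules M^n_j; each of these counts fixed points, since g acts *)
(* on the span of an orbit of length l with characteristic polynomial X^l-1.  *)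
(*   Exactness away from middle indices is proved by induction on the ambient *)
(* subspace u.  Let L be a hyperplane not containing u and w = u :&: L.  The  *)
(* group of transvections with axis L and centre in w has order prime to p,   *)
(* so averaging splits every cycle into an invariant cycle and cycles that    *)
(* are invariant under a hyperplane h of w and average to zero.  The former   *)
(* live in a mapping cone over the complex of w, the latter in copies of the  *)
(* complex of h, shifted by one.                                              *)
Require Import Defs.
From HB Require Import structures.
From mathcomp Require Import all_boot all_order all_algebra.
From mathcomp Require Import fingroup pgroup algC mxrepresentation.
From mathcomp Require Import finfield separable cyclotomic.
From mathcomp Require Import zify.

Set Implicit Arguments.
Unset Strict Implicit.
Unset Printing Implicit Defensive.
Import Order.TTheory GRing.Theory Num.Theory.
Local Open Scope ring_scope.

(** * Covers in the subspace lattice, and the incidence map in coordinates *)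

Section Cover.
Variables (R : finFieldType) (n : nat).
Local Notation T := (subspace R n).
Local Notation q := #|R|.
Implicit Types x y u : T.

(** Write Z(k,i) and B(k,i) for the lifted eigenvalue sums of g on cycles and boundaries, and pi_j
    for its number of stable j-spaces. Once permutation modules are known to contribute their fixed
    points ([eig_sum_set]), rank-nullity for the i-th power of the incidence map on M_k gives pi_k =
    Z(k,i) + B(k-i,m-i) ([num_stableE]). With b_t = B(k+tm,i), the t-th term of the sum is then b_t
    - b_(t-1), plus Z - B at (k+tm,i), minus Z - B at (k-i+tm,m-i). Among all these indices only
    (k,i) itself is in the middle range, so only its Z - B survives; that is the character of the
    homology ([brauer_char_homology]), and the b_t telescope away.

    The substance is [incidence_exact], the vanishing of homology off the middle range. It is proved
    for all subspaces u at once, by induction on dim u. For a hyperplane L not containing u and w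
    the intersection of u and L, chains invariant under the transvections along w are pairs of
    chains of w. The twisted Leibniz rule [bdX_lift] reduces them to exactness of w at (k,i+1) and
    (k-1,i-1) ([exact_cone]); the coefficients that occur are invertible because q and [j]_q for 0 <
    j < m are nonzero in F. Chains invariant along a hyperplane h of w, and with zero sum along the
    remaining direction, become families of q chains of h with zero total, on which the incidence
    map acts componentwise ([exact_codim1]). Sums over lines of transvections reduce every chain to
    these two kinds ([sigma_plane], [exact_sinvariant]). *)

Definition covers x y := (y <= x)%VS && ((\dim y).+1 == \dim x).

Lemma dim_addv_line y v : v \notin y -> \dim (y + <[v]>) = (\dim y).+1.
Proof.
move=> vy; rewrite dimv_disjoint_sum ?dim_vline.
  by case: eqP vy => [->|_ _]; rewrite ?mem0v // addn1.
apply/eqP; rewrite -subv0; apply/subvP=> w /memv_capP[wy /vlineP[k kw]].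
rewrite memv0 kw; have [->|k0] := eqVneq k 0; first by rewrite scale0r.
case/negP: vy; rewrite -[v]scale1r -(mulVf k0) -scalerA -kw.
exact: memvZ.
Qed.

Lemma covers_addv_line x y v :
  (v \notin y) && ((y + <[v]>)%VS == x) = covers x y && ((v \in x) && (v \notin y)).
Proof.
apply/andP/and3P => [[vy /eqP<-]|[/andP[yx /eqP dx] vx vy]].
  split; [|by rewrite memvE addvSr|by []].
  by rewrite /covers addvSl dim_addv_line ?eqxx.
by split=> //; rewrite eqEdim subv_add yx -memvE vx /= dim_addv_line // -dx.
Qed.

Lemma card_setDv x y : (y <= x)%VS ->
  #|[set v | (v \in x) && (v \notin y)]| = (q ^ \dim x - q ^ \dim y)%N.
Proof.
move=> yx; rewrite -!card_vspace.
have -> : [set v | (v \in x) && (v \notin y)] = [set v in x] :\: [set v in y].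
  by apply/setP=> v; rewrite !inE andbC.
rewrite cardsD (setIidPr _) ?cardsE //; apply/subsetP=> v; rewrite !inE.
exact: (subvP yx).
Qed.

(** Double count of the vectors of u outside y: each spans with y a unique cover, and a cover x
    arises from q^(dim x) - q^(dim y) = q^(dim y) (q - 1) of them. *)
Lemma card_covers_q1 u y : (y <= u)%VS ->
  (#|[set x | covers x y && (x <= u)%VS]| * q.-1 = (q ^ (\dim u - \dim y)).-1)%N.
Proof.
move=> yu; have q0 : (0 < q)%N by apply/card_gt0P; exists 0.
have qy0 : (0 < q ^ \dim y)%N by rewrite expn_gt0 q0.
apply/eqP; rewrite -(eqn_pmul2r qy0); apply/eqP.
have -> : ((q ^ (\dim u - \dim y)).-1 * q ^ \dim y)%N = (q ^ \dim u - q ^ \dim y)%N.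
  by rewrite -subn1 mulnBl -expnD mul1n subnK // dimvS.
rewrite -card_setDv // -[RHS]sum1_card.
rewrite (partition_big (fun v => (y + <[v]>)%VS : T)
  [pred x : T | covers x y && (x <= u)%VS]) /=; last first.
  move=> v; rewrite inE => /andP[vu vy]; have := covers_addv_line (y + <[v]>)%VS y v.
  by rewrite vy eqxx /= => /esym/andP[-> _]; rewrite subv_add yu -memvE.
rewrite -mulnA -sum_nat_const; apply: eq_big => [x|x]; rewrite inE // => /andP[cx xu].
have /andP[yx /eqP dx] := cx.
transitivity (q ^ \dim x - q ^ \dim y)%N.
  by rewrite -dx expnS -subn1 mulnBl mul1n.
rewrite -card_setDv // -sum1_card; apply: eq_bigl => v.
rewrite !inE; have := covers_addv_line x y v; rewrite cx /= => <-.
rewrite -andbA; case: (boolP (v \in u)) => //= vu.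
apply/negbTE; apply: contra vu => /andP[_ /eqP ex].
by apply: (subvP xu); rewrite -ex memvE addvSr.
Qed.

Lemma card_covers u y : (y <= u)%VS ->
  #|[set x | covers x y && (x <= u)%VS]| = (\sum_(j < \dim u - \dim y) q ^ j)%N.
Proof.
move=> yu; have q1 : (0 < q.-1)%N by have := finNzRing_gt1 R; case: q.
apply/eqP; rewrite -(eqn_pmul2r q1) card_covers_q1 // predn_exp.
by rewrite mulnC.
Qed.

(* The functions T -> F are the elements of the graded module, given by their *)
(* coordinates.                                                               *)
Variable F : fieldType.
Local Notation M := {ffun T -> F^o}.
Implicit Types z g : M.

Definition bd z : M := [ffun y => \sum_(x | covers x y) z x].

Fact bd_is_linear : linear bd.
Proof.
move=> a z g; apply/ffunP=> y; rewrite !ffunE scaler_sumr -big_split /=.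
by apply: eq_bigr => x _; rewrite !ffunE.
Qed.
HB.instance Definition _ := GRing.isLinear.Build F M M *:%R bd bd_is_linear.

Definition bdX i z := iter i bd z.
Fact bdX_is_linear i : linear (bdX i).
Proof. by elim: i => [|i IH] a z g //; rewrite /bdX !iterS -!/(bdX i _) IH linearP. Qed.
HB.instance Definition _ i := GRing.isLinear.Build F M M *:%R (bdX i) (bdX_is_linear i).

Lemma bdXS i z : bdX i.+1 z = bd (bdX i z). Proof. by []. Qed.
Lemma bdXSr i z : bdX i.+1 z = bdX i (bd z). Proof. by rewrite /bdX iterSr. Qed.
Lemma bdXD i j z : bdX (i + j) z = bdX i (bdX j z).
Proof. by rewrite /bdX iterD. Qed.

Definition supported u z := forall x, ~~ (x <= u)%VS -> z x = 0.
Definition homog (k : int) z := forall x, (\dim x)%:Z != k -> z x = 0.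

Lemma supportedB u z g : supported u z -> supported u g -> supported u (z - g).
Proof. by move=> sz sg x xu; rewrite !ffunE sz // sg // subr0. Qed.
Lemma supportedD u z g : supported u z -> supported u g -> supported u (z + g).
Proof. by move=> sz sg x xu; rewrite !ffunE sz // sg // addr0. Qed.
Lemma supportedZ u a z : supported u z -> supported u (a *: z).
Proof. by move=> sz x xu; rewrite !ffunE sz // scaler0. Qed.
Lemma supportedS u v z : (u <= v)%VS -> supported u z -> supported v z.
Proof. by move=> uv sz x xv; apply: sz; apply: contra xv => /subv_trans; apply. Qed.
Lemma supported_bd u z : supported u z -> supported u (bd z).
Proof.
move=> sz y yu; rewrite ffunE big1 // => x /andP[yx _]; apply: sz.
by apply: contra yu; apply: subv_trans.
Qed.
Lemma supported_bdX u i z : supported u z -> supported u (bdX i z).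
Proof. by move=> sz; elim: i => //= i; apply: supported_bd. Qed.

Lemma homogB k z g : homog k z -> homog k g -> homog k (z - g).
Proof. by move=> sz sg x xu; rewrite !ffunE sz // sg // subr0. Qed.
Lemma homogD k z g : homog k z -> homog k g -> homog k (z + g).
Proof. by move=> sz sg x xu; rewrite !ffunE sz // sg // addr0. Qed.
Lemma homogZ k a z : homog k z -> homog k (a *: z).
Proof. by move=> sz x xu; rewrite !ffunE sz // scaler0. Qed.
Lemma homog_bd k z : homog k z -> homog (k - 1) (bd z).
Proof.
move=> sz y yk; rewrite ffunE big1 // => x /andP[_ /eqP dx]; apply: sz.
by rewrite -dx; lia.
Qed.
Lemma homog_bdX k i z : homog k z -> homog (k - i%:Z) (bdX i z).
Proof.
move=> sz; elim: i => [|i IH]; first by rewrite subr0.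
have -> : k - i.+1%:Z = k - i%:Z - 1 by lia.
exact: homog_bd.
Qed.

(* The product is the number of maximal chains from y up to x. *)
Lemma bdXE j z y :
  bdX j z y = (\prod_(l < j) qint F q l.+1) *
              \sum_(x : T | (y <= x)%VS && (\dim x == \dim y + j)%N) z x.
Proof.
elim: j y => [|j IH] y.
  rewrite big_ord0 mul1r /bdX /= (big_pred1 y) // => x.
  rewrite /= addn0 [RHS]eq_sym eqEdim; case: (boolP (y <= x)%VS) => //= yx.
  by rewrite eqn_leq (dimvS yx) andbT.
rewrite bdXS ffunE.
under eq_bigr => w _ do rewrite IH.
rewrite -mulr_sumr big_ord_recr /= -mulrA; congr (_ * _).
rewrite (exchange_big_dep (fun x : T => (y <= x)%VS && (\dim x == \dim y + j.+1)%N)) /=.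
  rewrite mulr_sumr; apply: eq_bigr => x /andP[yx /eqP dx].
  rewrite (eq_bigl (fun w : T => w \in [set w | covers w y && (w <= x)%VS])).
    rewrite sumr_const card_covers // dx addKn -[LHS]mulr_natl natr_sum.
    by congr (_ * _); apply: eq_bigr => l _; rewrite natrX.
  move=> w; rewrite inE; case: (boolP (covers w y)) => //= /andP[_ /eqP<-].
  by rewrite dx addSnnS eqxx andbT.
move=> w x /andP[yw /eqP <-] /andP[wx /eqP ->]; rewrite (subv_trans yw wx).
by rewrite addSnnS eqxx.
Qed.

Lemma bdX_qchar m z : (0 < m)%N -> qint F q m = 0 -> bdX m z = 0.
Proof.
case: m => // m _ m0; apply/ffunP=> y; rewrite bdXE big_ord_recr /= m0.
by rewrite mulr0 mul0r ffunE.
Qed.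
End Cover.

(** * Lifting chains from a hyperplane section *)

Section Lift.
Variables (R : finFieldType) (n : nat) (F : fieldType).
Local Notation T := (subspace R n).
Local Notation q := #|R|.
Local Notation M := {ffun T -> F^o}.
Implicit Types (x y u h : T) (z g : M).

Definition hyperplane (L : T) := forall x, ~~ (x <= L)%VS -> (\dim (x :&: L)).+1 = \dim x.

Variable L : T.
Hypothesis hypL : hyperplane L.

(** By the modular law. Together with [addv_cap_covers], meeting with L and adding x become inverse
    bijections between the covers of x and the covers of [x :&: L] inside L, which is the reindexing
    in [bd_lift]. *)
Lemma covers_addv_hyperplane x y : ~~ (x <= L)%VS ->
  covers (x + y)%VS x && (((x + y) :&: L)%VS == y)
    = covers y (x :&: L)%VS && (y <= L)%VS.
Proof.
move=> xL; apply/andP/andP => [[/andP[_ /eqP dxy] /eqP exy]|[/andP[xy /eqP dy] yL]].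
  have xyL : ~~ (x + y <= L)%VS by apply: contra xL; apply/subv_trans/addvSl.
  rewrite -exy /covers !capvSr capvS ?addvSl //=; split=> //.
  by rewrite hypL // -eqSS hypL // dxy.
have cap : (x :&: y)%VS = (x :&: L)%VS.
  apply/eqP; rewrite eqEsubv; apply/andP; split; first by rewrite capvS.
  by rewrite subv_cap capvSl.
split; last first.
  by rewrite addvC -vspace_modl // (addv_idPl xy).
rewrite /covers addvSl /=; apply/eqP.
have := dimv_sum_cap x y; rewrite cap; have := hypL xL; lia.
Qed.

Lemma addv_cap_covers x y : covers y x -> ~~ (x <= L)%VS -> (x + y :&: L)%VS = y.
Proof.
move=> /andP[xy /eqP dxy] xL.
have yL : ~~ (y <= L)%VS by apply: contra xL; apply: subv_trans.
apply/eqP; rewrite eqEdim subv_add xy capvSl /=.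
have := dimv_sum_cap x (y :&: L); rewrite capvA (capv_idPl xy).
have := hypL xL; have := hypL yL; lia.
Qed.

(* The basis vector of y goes to the sum of those of the x <= u with          *)
(* x :&: L = y that are not contained in L.                                   *)
Definition cone_lift u g : M :=
  [ffun x : T => if (x <= u)%VS && ~~ (x <= L)%VS then g (x :&: L)%VS else 0].

Fact lift_is_linear u : linear (cone_lift u).
Proof.
by move=> a z g; apply/ffunP=> y; rewrite !ffunE; case: ifP => _; rewrite ?ffunE // scaler0 addr0.
Qed.
HB.instance Definition _ u := GRing.isLinear.Build F M M *:%R (cone_lift u) (lift_is_linear u).

Lemma supported_lift u g : supported u (cone_lift u g).
Proof. by move=> x /negbTE xu; rewrite ffunE xu. Qed.

Lemma homog_lift k u g : homog k g -> homog (k + 1) (cone_lift u g).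
Proof.
move=> hg x xk; rewrite ffunE; case: ifP => // /andP[_ xL]; apply: hg.
by apply: contra xk => /eqP <-; rewrite -(hypL xL); lia.
Qed.

(** For y outside L, covers of y correspond to covers of [y :&: L] in L, giving the first term. For
    y in L, the lift sees only the covers of y in u outside L; it has value [g y] on each, and they
    number [d+1]_q - [d]_q = q^d with d = dim (u :&: L) - dim y. *)
Lemma bd_lift u g : ~~ (u <= L)%VS -> supported (u :&: L)%VS g ->
  bd (cone_lift u g) = cone_lift u (bd g) +
    [ffun y : T => q%:R ^+ (\dim (u :&: L) - \dim y) * g y].
Proof.
move=> uL sg; apply/ffunP=> y; rewrite !ffunE.
case: (boolP (y <= u)%VS) => [yu|yu]; last first.
  rewrite sg ?subv_cap ?(negbTE yu) // mulr0 addr0.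
  apply: big1 => x /andP[yx _]; rewrite ffunE; case: ifP => // /andP[xu _].
  by case/negP: yu; apply: subv_trans xu.
case: (boolP (y <= L)%VS) => [yL|yL] /=; last first.
  rewrite sg ?subv_cap ?(negbTE yL) ?andbF // mulr0 addr0.
  rewrite (bigID (fun x : T => x <= u)%VS) /= [X in _ + X]big1 ?addr0; last first.
    by move=> x /andP[_ /negbTE xu]; rewrite ffunE xu.
  rewrite [RHS](bigID (fun x : T => x <= u :&: L)%VS) /= [X in _ = _ + X]big1 ?addr0; last first.
    by move=> x /andP[_ xu]; rewrite sg.
  rewrite (reindex_onto (fun x : T => (y + x)%VS : T) (fun x : T => (x :&: L)%VS : T)) /=; last first.
    by move=> x /andP[cx _]; apply: addv_cap_covers.
  apply: eq_big => [x|x].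
    rewrite subv_add yu /= andbAC covers_addv_hyperplane // subv_cap -andbA.
    by congr (_ && _); apply: andbC.
  case/andP=> /andP[/andP[yx _] xu] /eqP ex; rewrite ffunE xu /= ex.
  by rewrite ifT //; apply: contra yL; apply/subv_trans/addvSl.
rewrite add0r.
rewrite (bigID (fun x : T => (x <= u)%VS && ~~ (x <= L)%VS)) /= [X in _ + X]big1 ?addr0; last first.
  by move=> x /andP[_ /negbTE xu]; rewrite ffunE xu.
rewrite (eq_bigr (fun=> g y)) => [|x /andP[/andP[yx /eqP dx] /andP[xu xL]]]; last first.
  rewrite ffunE xu xL /=; congr (g _); apply/esym/eqP.
  by rewrite eqEdim subv_cap yx yL /= -ltnS hypL // dx.
rewrite sumr_const -[LHS]mulr_natl; congr (_ * _).
rewrite -natrX; congr (_%:R).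
have uE : [set x : T | covers x y && (x <= u)%VS] =
    [set x : T | covers x y && (x <= u)%VS && ~~ (x <= L)%VS] :|:
    [set x : T | covers x y && (x <= u :&: L)%VS].
  by apply/setP=> x; rewrite !inE subv_cap; case: covers; case: (x <= u)%VS; case: (x <= L)%VS.
have := card_covers yu; rewrite uE cardsU (_ : _ :&: _ = finset.set0) ?cards0 ?subn0; last first.
  by apply/setP=> x; rewrite !inE subv_cap; case: covers; case: (x <= u)%VS; case: (x <= L)%VS.
have yuL : (y <= u :&: L)%VS by rewrite subv_cap yu.
rewrite card_covers //; have <- := hypL uL; rewrite subSn ?dimvS // big_ord_recr /= addnC.
move/addnI=> <-; apply: eq_card => x; by rewrite !inE -andbA.
Qed.

Lemma homog_gt_dim u (k : int) z : supported u z -> homog k z -> (\dim u)%:Z < k -> z = 0.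
Proof.
move=> sz hz ku; apply/ffunP=> x; rewrite [RHS]ffunE.
case: (boolP (x <= u)%VS) => [xu|/sz->//]; apply: hz.
by apply: contraTneq ku => <-; have := dimvS xu; lia.
Qed.

(** Each application of [bd] lowers the degree by one and so raises the power of q in [bd_lift] by
    one; the corrections add up to q^e (1 + q + ... + q^(j-1)). At j = 0 the factor [0]_q = 0 makes
    the value of [j.-1] irrelevant. *)
Lemma bdX_lift u k j g : ~~ (u <= L)%VS -> supported (u :&: L)%VS g -> homog k g ->
  bdX j (cone_lift u g) = cone_lift u (bdX j g) +
    (q%:R ^+ `|(\dim (u :&: L))%:Z - k| * qint F q j) *: bdX j.-1 g.
Proof.
move=> uL sg hg.
(* If k exceeds this dimension then g = 0; otherwise the absolute value is a genuine difference. *)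
have [kd|kd] := ltP (\dim (u :&: L))%:Z k.
  by rewrite (homog_gt_dim sg hg kd) !linear0 addr0.
elim: j => [|j IH]; first by rewrite /qint big_ord0 mulr0 scale0r addr0.
rewrite bdXS IH linearD linearZ /= bd_lift //; last exact: supported_bdX.
rewrite -addrA -bdXS; congr (_ + _).
rewrite [qint F q j.+1]/qint big_ord_recr /= -/(qint F q j) mulrDr scalerDl addrC.
congr (_ + _); first by case: j {IH} => // ; rewrite /qint big_ord0 mulr0 !scale0r.
apply/ffunP=> y; rewrite !ffunE.
have [->|nz] := eqVneq (bdX j g y) 0; first by rewrite mulr0 scaler0.
have dy : (\dim y)%:Z = k - j%:Z.
  by apply/eqP; apply: contra_neqT nz; apply: homog_bdX.
rewrite -exprD; congr (_ ^+ _ * _).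
lia.
Qed.
End Lift.

(** * Exactness of the mapping cone over a hyperplane section *)

Section Exactness.
Variables (R : finFieldType) (n : nat) (F : fieldType).
Local Notation T := (subspace R n).
Local Notation q := #|R|.
Local Notation M := {ffun T -> F^o}.
Implicit Types (x y u h w : T) (z g a b : M) (k : int) (i j : nat).

Variable m : nat.
Hypothesis Hm : is_quantum_char F q m.
Hypothesis q_neq0 : q%:R != 0 :> F.

Lemma qint_neq0 j : (0 < j < m)%N -> qint F q j != 0.
Proof.
case: j => [//|[|j]] /andP[_ jm]; first by rewrite /qint big_ord1 oner_neq0.
by case: Hm => _ _ /(_ j.+2 isT) Hj; apply/eqP=> /Hj; rewrite leqNgt jm.
Qed.

Lemma bdX_m z : bdX m z = 0.
Proof. by case: Hm => m1 m0 _; apply: bdX_qchar => //; apply: ltnW. Qed.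

Definition is_boundary u k i z :=
  exists z', [/\ supported u z', homog (k + m%:Z - i%:Z) z' & bdX (m - i) z' = z].

(** Stated relative to u, which varies in the induction. At i = 0 and i = m it holds trivially; the
    cone construction does reach these values. *)
Definition exact_at u k i :=
  forall z, supported u z -> homog k z -> bdX i z = 0 -> is_boundary u k i z.

Lemma is_boundaryD u k i z g : is_boundary u k i z -> is_boundary u k i g -> is_boundary u k i (z + g).
Proof.
move=> [z' [sz hz <-]] [g' [sg hg <-]]; exists (z' + g'); rewrite linearD.
by split=> //; [apply: supportedD|apply: homogD].
Qed.

Lemma is_boundaryZ u k i (c : F) z : is_boundary u k i z -> is_boundary u k i (c *: z).
Proof.
move=> [z' [sz hz <-]]; exists (c *: z'); rewrite linearZ.
by split=> //; [apply: supportedZ|apply: homogZ].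
Qed.

Lemma is_boundary_sum u k i (I : finType) (f : I -> M) :
  (forall t, is_boundary u k i (f t)) -> is_boundary u k i (\sum_t f t).
Proof.
move=> Hf; elim/big_ind: _ => //; last by move=> z g; apply: is_boundaryD.
by exists 0; rewrite linear0; split=> // x _; rewrite ffunE.
Qed.

Section Cone.
Variables (L u : T).
Hypotheses (hypL : hyperplane L) (uL : ~~ (u <= L)%VS).
Local Notation w := (u :&: L)%VS.

Lemma exists_cap y : (y <= w)%VS ->
  exists x, [/\ (x <= u)%VS, ~~ (x <= L)%VS & (x :&: L)%VS = y].
Proof.
rewrite subv_cap => /andP[yu yL]; case/subvPn: uL => v vu vL.
have xL : ~~ (y + <[v]> <= L)%VS.
  by apply: contra vL; rewrite memvE; apply/subv_trans/addvSr.
exists (y + <[v]>)%VS; split=> //; first by rewrite subv_add yu -memvE.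
apply/esym/eqP; rewrite eqEdim subv_cap addvSl yL /= -ltnS hypL //.
by rewrite dim_addv_line //; apply: contra vL; apply: (subvP yL).
Qed.

Lemma lift_eq0 b : supported w b -> cone_lift L u b = 0 -> b = 0.
Proof.
move=> sb b0; apply/ffunP=> y; rewrite [RHS]ffunE.
case: (boolP (y <= w)%VS) => [yw|/sb//].
have [x [xu xL <-]] := exists_cap yw.
by have := congr1 (fun f : M => f x) b0; rewrite /cone_lift !ffunE xu xL.
Qed.

(** The supports are disjoint: a lives on subspaces of L, the lift outside L. The lift is injective
    since every y in w is the trace on L of some subspace of u. *)
Lemma add_lift_eq0 a b : supported w a -> supported w b -> a + cone_lift L u b = 0 ->
  a = 0 /\ b = 0.
Proof.
move=> sa sb ab0.
have a0 : a = 0.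
  apply/ffunP=> x; rewrite [RHS]ffunE.
  case: (boolP (x <= w)%VS) => [|/sa//]; rewrite subv_cap => /andP[_ xL].
  by have := congr1 (fun f : M => f x) ab0; rewrite !ffunE xL andbF addr0.
by split=> //; apply: lift_eq0 => //; rewrite -ab0 a0 add0r.
Qed.

(** The cycle condition forces [bdX i b = 0] and [bdX i.+1 a = 0]. A boundary built from a preimage
    of a removes a and leaves a pure lift of some [b1]; its cycle condition gives the stronger
    [bdX i.-1 b1 = 0], because [i]_q is invertible. *)
Lemma exact_cone k i a b : (0 < i < m)%N ->
  supported w a -> homog k a -> supported w b -> homog (k - 1) b ->
  exact_at w k i.+1 -> exact_at w (k - 1) i.-1 ->
  bdX i (a + cone_lift L u b) = 0 -> is_boundary u k i (a + cone_lift L u b).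
Proof.
move=> im sa ha sb hb exa exb cyc.
have wu : (w <= u)%VS by apply: capvSl.
have qX e : q%:R ^+ e != 0 :> F by rewrite expf_neq0.
have bdXlift k' j g := @bdX_lift _ _ F _ hypL u k' j g uL.
have b0 : bdX i b = 0.
  move: cyc; rewrite linearD /= (bdXlift _ _ _ sb hb) addrCA addrC.
  case/add_lift_eq0 => //; last exact: supported_bdX.
  by apply: supportedD; [|apply: supportedZ]; apply: supported_bdX.
have a0 : bdX i.+1 a = 0.
  have := congr1 (@bd _ _ _) cyc; rewrite linear0 linearD linearD /= (bdXlift _ _ _ sb hb).
  rewrite b0 linear0 add0r linearZ /= -!bdXS prednK; last by case/andP: im.
  by rewrite b0 scaler0 addr0.
have [b' [sb' hb' eb']] := exa a sa ha a0.
pose c : F := q%:R ^+ `|(\dim w)%:Z - (k + m%:Z - i.+1%:Z)%R| * qint F q (m - i).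
have c_neq0 : c != 0 by rewrite mulf_neq0 // qint_neq0 //; lia.
have bda : bdX (m - i) b' = bd a.
  have -> : (m - i = (m - i.+1).+1)%N by lia.
  by rewrite bdXS eb'.
have lift_b' : bdX (m - i) (cone_lift L u b') = cone_lift L u (bd a) + c *: a.
  by rewrite (bdXlift _ _ _ sb' hb') bda -subnS eb'.
(* What remains of b once the boundary of [c^-1 *: cone_lift L u b'] has accounted for a. *)
pose b1 := b - c^-1 *: bd a.
have sb1 : supported w b1 by apply: supportedB => //; apply/supportedZ/supported_bd.
have hb1 : homog (k - 1) b1 by apply: homogB => //; apply/homogZ/homog_bd.
have zE : a + cone_lift L u b = c^-1 *: bdX (m - i) (cone_lift L u b') + cone_lift L u b1.
  rewrite lift_b' /b1 linearB /= linearZ /= scalerDr scalerA mulVf // scale1r.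
  by apply/esym; rewrite [_ + a]addrC -addrA; congr (a + _); rewrite addrC subrK.
clearbody b1; have b10 : bdX i.-1 b1 = 0.
  move: cyc; rewrite zE linearD linearZ /= -bdXD subnKC; last by lia.
  rewrite bdX_m scaler0 add0r (bdXlift _ _ _ sb1 hb1) [X in X = 0 -> _]addrC.
  case/add_lift_eq0 => //; try by do ?apply: supportedZ; apply: supported_bdX.
  move=> /eqP; rewrite scaler_eq0 mulf_eq0 (negbTE (qX _)) (negbTE (qint_neq0 im)) /=.
  by move/eqP.
have [b2 [sb2 hb2 eb2]] := exb b1 sb1 hb1 b10.
have sb2' := supported_bd sb2.
have hb2' : homog (k + m%:Z - i.+1%:Z) (bd b2).
  have -> : k + m%:Z - i.+1%:Z = k - 1 + m%:Z - i.-1%:Z - 1 by lia.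
  exact: homog_bd.
(* The image of the lift of [bd b2] is the lift of [b1] plus [c *: bdX (m - i) b2], and the term in
   [b2] cancels the excess. The constant is again c because [bd b2] has the same degree as [b']. *)
exists (c^-1 *: cone_lift L u b' + (cone_lift L u (bd b2) - c *: b2)); split.
- apply: supportedD; first by apply/supportedZ/supported_lift.
  apply: supportedB; first exact: supported_lift.
  by apply: supportedZ; apply: supportedS sb2.
- have eH : k + m%:Z - i%:Z = k + m%:Z - i.+1%:Z + 1 by lia.
  apply: homogD; first by apply: homogZ; rewrite eH; apply: homog_lift.
  apply: homogB; first by rewrite eH; apply: homog_lift.
  apply: homogZ; have -> // : k + m%:Z - i%:Z = k - 1 + m%:Z - i.-1%:Z by lia.
rewrite zE !linearD linearN !linearZ /= (bdXlift _ _ _ sb2' hb2') -!bdXSr.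
rewrite prednK -/c; last by lia.
have -> : (m - i).+1 = (m - i.-1)%N by lia.
by rewrite eb2 scalerN addrK.
Qed.
End Cone.
End Exactness.

(** * Transvections with a fixed axis *)

Section Shear.
Variables (R : finFieldType) (n : nat) (F : fieldType).
Local Notation T := (subspace R n).
Local Notation q := #|R|.
Local Notation M := {ffun T -> F^o}.
Variable c : 'cV[R]_n.
Implicit Types (x y u S : T) (z g : M) (v w a : 'rV[R]_n).

Definition ker_col : T := lker (linfun (mulmxr c) : 'Hom('rV[R]_n, 'M[R]_1)).
Local Notation L := ker_col.

Lemma mem_ker_col v : (v \in L) = (v *m c == 0).
Proof. by rewrite memv_ker lfunE. Qed.

Lemma hyperplane_ker_col : hyperplane L.
Proof.
move=> x xL; have := limg_ker_dim (linfun (mulmxr c) : 'Hom('rV[R]_n, 'M[R]_1)) x.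
rewrite -/L; set d := \dim (_ @: x) => <-.
have d1 : (d <= 1)%N by rewrite -[1%N](dim_matrix R 1 1) -dimvf dimvS ?subvf.
suff d0 : (0 < d)%N by have -> : d = 1%N; [apply/eqP; rewrite eqn_leq d1|rewrite addn1].
by rewrite lt0n; apply: contra xL; rewrite /d dimv_eq0 lkerE.
Qed.

(** For w in L this is the action of the transvection v |-> v + (v c) w, with axis L and centre
    spanned by w; for other w the map need not be invertible. *)
Definition shear w x : T := (linfun (mulmxr (1%:M + c *m w)) @: x)%VS.

Lemma shear_id w x : (forall v, v \in x -> v *m c *m w = 0) -> shear w x = x.
Proof.
move=> wx; have id v : v \in x -> linfun (mulmxr (1%:M + c *m w)) v = v.
  by move=> vx; rewrite lfunE /= mulmxDr mulmx1 mulmxA wx // addr0.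
apply/eqP; rewrite eqEsubv; apply/andP; split; apply/subvP=> v.
  by case/memv_imgP=> b bx ->; rewrite id.
by move=> vx; rewrite -(id v vx) memv_img.
Qed.

Lemma shear0 x : shear 0 x = x.
Proof. by apply: shear_id => v _; rewrite mulmx0. Qed.

Lemma shear_ker w x : (x <= L)%VS -> shear w x = x.
Proof.
move=> xL; apply: shear_id => v /(subvP xL); rewrite mem_ker_col => /eqP->.
by rewrite mul0mx.
Qed.

Lemma shearD w v x : w \in L -> shear (w + v) x = shear v (shear w x).
Proof.
rewrite mem_ker_col => /eqP wc; rewrite /shear -limg_comp; congr (_ @: _)%VS.
apply/lfunP=> b; rewrite comp_lfunE !lfunE /= -mulmxA; congr (_ *m _).
rewrite [RHS]mulmxDl mul1mx [c *m w *m _]mulmxDr mulmx1 -[c *m w *m _]mulmxA.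
by rewrite [w *m _]mulmxA wc mul0mx mulmx0 addr0 mulmxDr [c *m w + _]addrC addrA.
Qed.

Lemma shearK w : w \in L -> cancel (shear w) (shear (- w)).
Proof. by move=> wL x; rewrite -shearD // subrr shear0. Qed.

Lemma shearS w x y : (x <= y)%VS -> (shear w x <= shear w y)%VS.
Proof. exact: limgS. Qed.

Lemma shearSE w x y : w \in L -> (shear w x <= shear w y)%VS = (x <= y)%VS.
Proof.
move=> wL; apply/idP/idP=> [|/shearS//] /(@shearS (- w)).
by rewrite !shearK.
Qed.

Lemma dim_shear w x : w \in L -> \dim (shear w x) = \dim x.
Proof.
have le v y : (\dim (shear v y) <= \dim y)%N.
  by rewrite -(limg_ker_dim (linfun (mulmxr (1%:M + c *m v))) y) leq_addl.
by move=> wL; apply/eqP; rewrite eqn_leq le -{1}(shearK wL x) le.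
Qed.

Lemma shear_mem w x : w \in L -> w \in x -> shear w x = x.
Proof.
move=> wL wx; apply/eqP; rewrite eqEdim dim_shear // leqnn andbT.
apply/subvP=> v /memv_imgP[b bx ->]; rewrite lfunE /= mulmxDr mulmx1 mulmxA.
by rewrite memvD // [b *m c]mx11_scalar mul_scalar_mx memvZ.
Qed.

End Shear.

(** * Action of transvections on chains *)

Section ShearChains.
Variables (R : finFieldType) (n : nat) (F : fieldType).
Local Notation T := (subspace R n).
Local Notation q := #|R|.
Local Notation M := {ffun T -> F^o}.
Variable c : 'cV[R]_n.
Implicit Types (x y u S : T) (z g : M) (v w a : 'rV[R]_n).
Local Notation L := (ker_col c).
Local Notation hypL := (@hyperplane_ker_col _ _ c).

Lemma exists_col1 x : ~~ (x <= L)%VS -> exists2 v, v \in x & v *m c = 1%:M.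
Proof.
case/subvPn=> v vx; rewrite mem_ker_col => vc.
have vc0 : (v *m c) 0 0 != 0.
  by apply: contra vc => /eqP e; rewrite [v *m c]mx11_scalar e raddf0.
exists (((v *m c) 0 0)^-1 *: v); first exact: memvZ.
by rewrite -scalemxAl {2}(mx11_scalar (v *m c)) scale_scalar_mx mulVf.
Qed.

Lemma col1_notin v : v *m c = 1%:M -> v \notin L.
Proof. by move=> vc; rewrite mem_ker_col vc oner_neq0. Qed.

Lemma addv_col1 x v : v \in x -> v *m c = 1%:M -> (x :&: L + <[v]>)%VS = x.
Proof.
move=> vx vc; have vL := col1_notin vc.
have xL : ~~ (x <= L)%VS by apply/subvPn; exists v.
apply/eqP; rewrite eqEdim subv_add capvSl -memvE vx /=.
rewrite dim_addv_line; first by rewrite (hypL xL) leqnn.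
by apply: contra vL => /memv_capP[].
Qed.

Lemma shear_line w y v : w \in L -> v *m c = 1%:M -> (y <= L)%VS ->
  shear c w (y + <[v]>)%VS = (y + <[v + w]>)%VS.
Proof.
move=> wL vc yL; rewrite /shear limgD -/(shear c w y) shear_ker // limg_line.
by rewrite lfunE /= mulmxDr mulmx1 mulmxA vc mul1mx.
Qed.

(** Take a vector of x' with value 1 under c and decompose it along [x + S]: its component in S is
    the required w. *)
Lemma shear_orbit S x x' : (S <= L)%VS -> ~~ (x <= L)%VS -> ~~ (x' <= L)%VS ->
  (x :&: L)%VS = (x' :&: L)%VS -> (x' <= x + S)%VS ->
  exists2 w, w \in S & shear c w x = x'.
Proof.
move=> SL xL x'L exx sx'; have [v' vx' vc'] := exists_col1 x'L.
case/memv_addP: (subvP sx' _ vx') => v vx [w wS ev].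
have wL := subvP SL _ wS; have vc : v *m c = 1%:M.
  by rewrite -vc' ev mulmxDl; move: wL; rewrite mem_ker_col => /eqP->; rewrite addr0.
exists w => //; rewrite -(addv_col1 vx vc) shear_line ?capvSr // exx -ev.
exact: addv_col1.
Qed.

Definition tau w z : M := [ffun x : T => z (shear c w x)].

Fact tau_is_linear w : linear (tau w).
Proof. by move=> a z g; apply/ffunP=> y; rewrite !ffunE. Qed.
HB.instance Definition _ w := GRing.isLinear.Build F M M *:%R (tau w) (tau_is_linear w).

Lemma shear_inj w : w \in L -> injective (shear c w : T -> T).
Proof. by move=> wL; apply: can_inj (shearK wL). Qed.

Lemma bd_tau w z : w \in L -> bd (tau w z) = tau w (bd z).
Proof.
move=> wL; apply/ffunP=> y; rewrite !ffunE [RHS](reindex_inj (shear_inj wL)) /=.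
apply: eq_big => [x|x _]; last by rewrite ffunE.
by rewrite /covers shearSE // !dim_shear.
Qed.

Lemma bdX_tau i w z : w \in L -> bdX i (tau w z) = tau w (bdX i z).
Proof. by move=> wL; elim: i => // i IH; rewrite !bdXS IH bd_tau. Qed.

Lemma homog_tau k w z : w \in L -> homog k z -> homog k (tau w z).
Proof. by move=> wL hz x xk; rewrite ffunE hz // dim_shear. Qed.

Lemma supported_tau u w z : w \in L -> w \in u -> supported u z -> supported u (tau w z).
Proof.
move=> wL wu sz x xu; rewrite ffunE sz //; apply: contra xu.
by rewrite -{1}(shear_mem wL wu) shearSE.
Qed.

Definition sinvariant S z := forall w, w \in S -> tau w z = z.

Lemma sinvariantE S z w x : sinvariant S z -> w \in S -> z (shear c w x) = z x.
Proof. by move=> iz wS; rewrite -{2}(iz w wS) ffunE. Qed.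

(** This is q times the average over the transvections along the line of a, left unnormalised. *)
Definition sigma a z : M := \sum_(t : R) tau (t *: a) z.

Lemma sigmaE a z x : sigma a z x = \sum_(t : R) z (shear c (t *: a) x).
Proof. by rewrite sum_ffunE; apply: eq_bigr => t _; rewrite ffunE. Qed.

Fact sigma_is_linear a : linear (sigma a).
Proof.
by move=> k z g; rewrite /sigma scaler_sumr -big_split; apply: eq_bigr => t _; rewrite linearP.
Qed.
HB.instance Definition _ a := GRing.isLinear.Build F M M *:%R (sigma a) (sigma_is_linear a).

Lemma bdX_sigma i a z : a \in L -> bdX i (sigma a z) = sigma a (bdX i z).
Proof. by move=> aL; rewrite linear_sum; apply: eq_bigr => t _; rewrite /= bdX_tau ?memvZ. Qed.

Lemma homog_sum (I : finType) k (f : I -> M) :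
  (forall t, homog k (f t)) -> homog k (\sum_t f t).
Proof. by move=> hf x xk; rewrite sum_ffunE big1 // => t _; apply: hf. Qed.

Lemma supported_sum (I : finType) u (f : I -> M) :
  (forall t, supported u (f t)) -> supported u (\sum_t f t).
Proof. by move=> hf x xk; rewrite sum_ffunE big1 // => t _; apply: hf. Qed.

Lemma homog_sigma k a z : a \in L -> homog k z -> homog k (sigma a z).
Proof. by move=> aL hz; apply: homog_sum => t; apply: homog_tau; rewrite ?memvZ. Qed.

Lemma supported_sigma u a z : a \in L -> a \in u -> supported u z -> supported u (sigma a z).
Proof. by move=> aL au sz; apply: supported_sum => t; apply: supported_tau; rewrite ?memvZ. Qed.

Lemma sinvariant_sigma S a z : (S <= L)%VS -> a \in L -> sinvariant S z ->
  sinvariant (S + <[a]>)%VS (sigma a z).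
Proof.
move=> SL aL iz w /memv_addP[s sS [_ /vlineP[r ->] ->]]; apply/ffunP=> x.
have sL := subvP SL _ sS.
rewrite ffunE !sigmaE [RHS](reindex_inj (addIr r)) /=; apply: eq_bigr => t _.
rewrite -shearD ?memvD ?memvZ // -addrA -scalerDl addrC shearD ?memvZ //.
by rewrite [r + t]addrC (sinvariantE _ iz sS).
Qed.

(** For independent a and b, the q + 1 lines of their plane cover each nonzero vector once and zero
    q + 1 times, while the iterated sum runs once over the plane; the excess is [q%:R *: z]. *)
Lemma sigma_plane a b z : a \in L -> b \in L ->
  \sum_(t : R) sigma (a + t *: b) z + sigma b z = q%:R *: z + sigma a (sigma b z).
Proof.
move=> aL bL; apply/ffunP=> x; rewrite !ffunE sum_ffunE !sigmaE.
under eq_bigr => t _ do rewrite sigmaE.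
under [in RHS]eq_bigr => s _ do rewrite sigmaE.
rewrite exchange_big (bigD1 0) // [in RHS](bigD1 0) //=.
under eq_bigr => t _ do rewrite scale0r shear0.
rewrite sumr_const -scaler_nat -[LHS]addrA; congr (_ + _).
rewrite addrC scale0r shear0; congr (_ + _); apply: eq_bigr => s s0.
rewrite [RHS](reindex_inj (mulfI s0)) /=; apply: eq_bigr => t _.
by rewrite -shearD ?memvZ // scalerDr scalerA.
Qed.
End ShearChains.

(** * Invariant chains, and chains that average to zero *)

Section ExactnessTheorem.
Variables (R : finFieldType) (n : nat) (F : fieldType).
Local Notation T := (subspace R n).
Local Notation q := #|R|.
Local Notation M := {ffun T -> F^o}.
Variable m : nat.
Hypothesis Hm : is_quantum_char F q m.
Hypothesis q_neq0 : q%:R != 0 :> F.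

Section Hyperplane.
Variables (c : 'cV[R]_n) (u : T) (v0 : 'rV[R]_n).
Hypotheses (v0u : v0 \in u) (v0c : v0 *m c = 1%:M).
Implicit Types (x y S : T) (z g : M) (v a : 'rV[R]_n) (k : int) (i : nat).
Local Notation L := (ker_col c).
Local Notation w := (u :&: L)%VS.
Local Notation hypL := (@hyperplane_ker_col _ _ c).

Let uL : ~~ (u <= L)%VS.
Proof. by apply/subvPn; exists v0; rewrite ?col1_notin. Qed.

Lemma addv_col1_subN y v : v *m c = 1%:M -> ~~ (y + <[v]> <= L)%VS.
Proof. by move/col1_notin => vL; apply/subvPn; exists v; rewrite // memvE addvSr. Qed.

Lemma cap_addv_col1 y v : (y <= L)%VS -> v *m c = 1%:M -> ((y + <[v]>) :&: L)%VS = y.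
Proof.
move=> yL vc; apply/esym/eqP; rewrite eqEdim subv_cap addvSl yL /=.
rewrite -ltnS (hypL (addv_col1_subN y vc)) dim_addv_line //.
by apply: contra (col1_notin vc); apply: (subvP yL).
Qed.

(** Recovers a chain from its lift: if [v *m c = 1%:M] and x is in L, then [x + <[v]>] meets L in
    x. *)
Definition line_coord v y z : M :=
  [ffun x : T => if (x <= y)%VS then z (x + <[v]>)%VS else 0].

Lemma supported_line_coord v y z : supported y (line_coord v y z).
Proof. by move=> x /negbTE xy; rewrite ffunE xy. Qed.

Lemma homog_line_coord k v y z : (y <= L)%VS -> v *m c = 1%:M ->
  homog k z -> homog (k - 1) (line_coord v y z).
Proof.
move=> yL vc hz x xk; rewrite ffunE; case: ifP => // xy; apply: hz.
rewrite dim_addv_line; first by apply: contra xk => /eqP <-; lia.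
by apply: contra (col1_notin vc); apply: (subvP (subv_trans xy yL)).
Qed.

(** Both arguments of z have the same trace on L, and [shear_orbit] joins them by a transvection
    along S. *)
Lemma sinvariant_line S z x v : (S <= L)%VS -> sinvariant c S z -> ~~ (x <= L)%VS ->
  v *m c = 1%:M -> (x <= S + <[v]>)%VS -> z (x :&: L + <[v]>)%VS = z x.
Proof.
move=> SL iz xL vc xS.
have [] := @shear_orbit _ _ c S (x :&: L + <[v]>)%VS x SL (addv_col1_subN _ vc) xL.
- by rewrite cap_addv_col1 ?capvSr.
- by apply: subv_trans xS _; rewrite addvC addvS ?addvSr.
by move=> s sS ex; rewrite -[LHS](sinvariantE _ iz sS) ex.
Qed.

(** Invariance makes z depend only on the trace on L for subspaces of u outside L, so that part of z
    is a lift and [exact_cone] applies. *)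
Lemma exact_invariant k i z : (0 < i < m)%N ->
  exact_at F m w k i.+1 -> exact_at F m w (k - 1) i.-1 ->
  supported u z -> homog k z -> sinvariant c w z -> bdX i z = 0 -> is_boundary m u k i z.
Proof.
move=> im exa exb sz hz iz cyc.
pose a : M := [ffun x : T => if (x <= L)%VS then z x else 0].
pose b := line_coord v0 w z.
have zE : z = a + cone_lift L u b.
  apply/ffunP=> x; rewrite !ffunE; case: (boolP (x <= L)%VS) => xL.
    by rewrite andbF addr0.
  rewrite andbT add0r; case: (boolP (x <= u)%VS) => [xu|/sz//].
  rewrite capvS // (sinvariant_line _ iz) ?capvSr //.
  by rewrite addv_col1.
rewrite zE; apply: (exact_cone Hm q_neq0 hypL uL im _ _ _ _ exa exb) => //.
- move=> x; rewrite subv_cap negb_and ffunE; case: ifP => // _; rewrite orbF.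
  by apply: sz.
- by move=> x xk; rewrite ffunE; case: ifP => // _; apply: hz.
- exact: supported_line_coord.
- by apply: homog_line_coord; rewrite ?capvSr.
by rewrite -zE.
Qed.

Section Codim1.
Variables (h : T) (a : 'rV[R]_n).
Hypotheses (hw : (h <= w)%VS) (aw : a \in w) (ah : a \notin h).
Hypothesis dimh : (\dim h).+1 = \dim w.

Let hL : (h <= L)%VS. Proof. by apply: subv_trans hw (capvSr _ _). Qed.
Let aL : a \in L. Proof. by case/memv_capP: aw. Qed.
Let ac : a *m c = 0. Proof. by apply/eqP; rewrite -mem_ker_col. Qed.
Let wE : (h + <[a]>)%VS = w.
Proof. by apply/eqP; rewrite eqEdim subv_add hw -memvE aw dim_addv_line // dimh leqnn. Qed.

(** The [ut t] are the q hyperplanes of u through h other than w. A subspace of u outside L with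
    trace in h lies in exactly one of them. *)
Let vt (t : R) := v0 + t *: a.
Let ut (t : R) : T := (h + <[vt t]>)%VS.

Let vtc t : vt t *m c = 1%:M.
Proof. by rewrite mulmxDl -scalemxAl ac scaler0 addr0. Qed.

Let utL t : ~~ (ut t <= L)%VS.
Proof. exact: addv_col1_subN. Qed.

Let ut_cap t : (ut t :&: L)%VS = h.
Proof. exact: cap_addv_col1. Qed.

Let ut_sub t : (ut t <= u)%VS.
Proof.
rewrite subv_add (subv_trans hw (capvSl _ _)) -memvE memvD // memvZ //.
by case/memv_capP: aw.
Qed.

Let ut_inj x t t' : ~~ (x <= L)%VS -> (x <= ut t)%VS -> (x <= ut t')%VS -> t = t'.
Proof.
move=> xL xt xt'; have [v vx vc] := exists_col1 xL.
have D s : (x <= ut s)%VS -> v - vt s \in h.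
  move/subvP/(_ _ vx)/memv_addP=> [y yh [_ /vlineP[r ->] ev]].
  have := vc; rewrite ev mulmxDl -scalemxAl vtc.
  have /eqP-> : y *m c == 0 by rewrite -mem_ker_col (subvP hL).
  rewrite add0r scalemx1 => /(congr1 (fun A : 'M_1 => A 0 0)); rewrite !mxE eqxx !mulr1n => ->.
  by rewrite scale1r addrK.
apply/eqP; rewrite -subr_eq0; apply: contraNT ah => tt'.
have := memvB (D _ xt') (D _ xt).
rewrite opprB [vt t - v]addrC addrACA subrr add0r [X in X \in _]addrC /vt opprD addrACA subrr add0r.
rewrite -scalerBl => /(memvZ (t - t')^-1).
by rewrite scalerA mulVf // scale1r.
Qed.

Let exists_ut x : (x <= u)%VS -> ~~ (x <= L)%VS -> (x :&: L <= h)%VS ->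
  exists t, (x <= ut t)%VS.
Proof.
move=> xu xL xh; have [v vx vc] := exists_col1 xL.
have : v - v0 \in w.
  apply/memv_capP; split; first by rewrite memvB // (subvP xu).
  by rewrite mem_ker_col mulmxBl vc v0c subrr.
rewrite -wE => /memv_addP[y yh [_ /vlineP[t ->] ev]].
exists t; rewrite -(addv_col1 vx vc) subv_add (subv_trans xh) ?addvSl //= -memvE.
have -> : v = y + vt t by rewrite /vt addrCA -ev addrC subrK.
by rewrite memvD // ?memvE ?addvSr // -memvE (subvP (addvSl _ _)).
Qed.

Let lift_sumE (G : R -> M) t x : ~~ (x <= L)%VS -> (x <= ut t)%VS ->
  (\sum_s cone_lift L (ut s) (G s)) x = G t (x :&: L)%VS.
Proof.
move=> xL xt; rewrite sum_ffunE (bigD1 t) //= ffunE xt xL /= big1 ?addr0 // => s st.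
rewrite ffunE; case: ifP => // /andP[xs _]; case/eqP: st.
exact: ut_inj xs xt.
Qed.

(** All [ut t] meet L in h, so [bdX_lift] gives the same coefficient to every summand, and the
    corrections add up to a multiple of [bdX j.-1] applied to the zero sum. *)
Let bdX_lift_sum k j (G : R -> M) : (forall t, supported h (G t)) ->
  (forall t, homog k (G t)) -> \sum_t G t = 0 ->
  bdX j (\sum_t cone_lift L (ut t) (G t)) = \sum_t cone_lift L (ut t) (bdX j (G t)).
Proof.
move=> sG hG G0; rewrite linear_sum /=.
under eq_bigr => t _.
  rewrite (@bdX_lift _ _ F _ hypL (ut t) k j (G t)) ?ut_cap //; over.
rewrite big_split /= -scaler_sumr -linear_sum /= G0 linear0 scaler0 addr0 //.
Qed.

(** Since [sigma c a z = 0], z vanishes wherever its values do not change along the line of a. It is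
    therefore a sum of lifts from h to the [ut t], with components [G t] of total zero, and
    exactness for h applies to each component. *)
Lemma exact_codim1 k i z : (0 < i < m)%N -> exact_at F m h (k - 1) i ->
  supported u z -> homog k z -> sinvariant c h z -> sigma c a z = 0 ->
  bdX i z = 0 -> is_boundary m u k i z.
Proof.
move=> im exh sz hz iz sz0 cyc.
have z0 x : (forall t : R, z (shear c (t *: a) x) = z x) -> z x = 0.
  move=> zt; have := congr1 (fun f : M => f x) sz0; rewrite sigmaE ffunE.
  rewrite (eq_bigr (fun=> z x)) // sumr_const -scaler_nat => /eqP.
  by rewrite scaler_eq0 (negbTE q_neq0) => /eqP.
pose G t := line_coord (vt t) h z.
have sG t : supported h (G t) by apply: supported_line_coord.
have hG t : homog (k - 1) (G t) by apply: homog_line_coord.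
have zE : z = \sum_t cone_lift L (ut t) (G t).
  apply/ffunP=> x; case: (boolP (x <= u)%VS) => xu; last first.
    rewrite sz // sum_ffunE big1 // => t _; rewrite ffunE; case: ifP => // /andP[xt _].
    by case/negP: xu; apply: subv_trans xt _.
  case: (boolP (x <= L)%VS) => xL.
    rewrite z0 => [|t]; last by rewrite shear_ker.
    by rewrite sum_ffunE big1 // => t _; rewrite ffunE xL andbF.
  case: (boolP (x :&: L <= h)%VS) => xh; last first.
    rewrite sum_ffunE big1 => [|t _]; last first.
      rewrite ffunE; case: ifP => // /andP[xt _]; case/negP: xh.
      by rewrite -(ut_cap t) capvS.
    apply: z0 => t; case/subvPn: xh => s /memv_capP[sx sL] sh.
    have sw : s \in w by rewrite memv_cap (subvP xu).
    (* Modulo h, a is a multiple of s: transvections along s fix x, which contains s, and those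
       along h preserve z. *)
    have : a \in (h + <[s]>)%VS.
      suff -> : (h + <[s]>)%VS = w by [].
      by apply/eqP; rewrite eqEdim subv_add hw -memvE sw dim_addv_line // dimh leqnn.
    case/memv_addP=> y yh [_ /vlineP[r ->] ->].
    rewrite scalerDr addrC shearD ?memvZ // (sinvariantE _ iz) ?memvZ //.
    by rewrite shear_mem ?memvZ.
  have [t xt] := exists_ut xu xL xh.
  by rewrite (lift_sumE _ xL xt) ffunE xh (sinvariant_line hL iz).
have G0 : \sum_t G t = 0.
  apply/ffunP=> y; rewrite sum_ffunE [RHS]ffunE.
  case: (boolP (y <= h)%VS) => yh; last by rewrite big1 // => t _; apply: sG.
  have := congr1 (fun f : M => f (y + <[v0]>)%VS) sz0; rewrite sigmaE [in RHS]ffunE.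
  move=> e; rewrite -[RHS]e; apply: eq_bigr => t _; rewrite ffunE yh shear_line ?memvZ //.
  exact: subv_trans hL.
have bG t : bdX i (G t) = 0.
  apply/ffunP=> y; rewrite [RHS]ffunE.
  case: (boolP (y <= h)%VS) => yh; last by rewrite (supported_bdX _ (sG t)).
  move: cyc; rewrite zE (bdX_lift_sum _ sG hG G0).
  move/(congr1 (fun f : M => f (y + <[vt t]>)%VS)); rewrite [in RHS]ffunE.
  have yL := subv_trans yh hL.
  rewrite (@lift_sumE (fun t => bdX i (G t)) t) ?addv_col1_subN ?addvS //.
  by rewrite cap_addv_col1.
have /fin_all_exists[G' HG'] t := exh (G t) (sG t) (hG t) (bG t).
(* The preimages need not have total zero. Their total is killed by [bdX (m - i)], because the [G t]
   sum to zero, so it can be subtracted from the component at 0. *)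
pose G1 t := G' t - (if t == 0 then \sum_s G' s else 0).
have sG' t : supported h (G' t) by case: (HG' t).
have hG' t : homog (k - 1 + m%:Z - i%:Z) (G' t) by case: (HG' t).
have eG1 t : bdX (m - i) (G1 t) = G t.
  have [_ _ eG'] := HG' t; rewrite /G1 linearB /= eG'; case: eqP => _.
    rewrite linear_sum /= (eq_bigr G) ?G0 ?subr0 // => s _.
    by case: (HG' s).
  by rewrite linear0 subr0.
have sG1 t : supported h (G1 t).
  apply: supportedB => //; case: ifP => _; first exact: supported_sum.
  by move=> x _; rewrite ffunE.
have hG1 t : homog (k - 1 + m%:Z - i%:Z) (G1 t).
  apply: homogB => //; case: ifP => _; first exact: homog_sum.
  by move=> x _; rewrite ffunE.
have G10 : \sum_t G1 t = 0.
  by rewrite /G1 big_split /= sumrN -big_mkcond big_pred1_eq subrr.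
exists (\sum_t cone_lift L (ut t) (G1 t)); split.
- apply: supported_sum => t; apply: supportedS (ut_sub t) _; exact: supported_lift.
- apply: homog_sum => t; have -> : k + m%:Z - i%:Z = k - 1 + m%:Z - i%:Z + 1 by lia.
  exact: (homog_lift hypL).
rewrite (bdX_lift_sum _ sG1 hG1 G10) [RHS]zE; apply: eq_bigr => t _.
by rewrite eG1.
Qed.
End Codim1.
End Hyperplane.
End ExactnessTheorem.

(** * Exactness away from the middle indices *)

Section ExactAll.
Variables (R : finFieldType) (n : nat) (F : fieldType).
Local Notation T := (subspace R n).
Local Notation q := #|R|.
Local Notation M := {ffun T -> F^o}.
Variable m : nat.
Hypothesis Hm : is_quantum_char F q m.
Hypothesis q_neq0 : q%:R != 0 :> F.
Implicit Types (x y u S : T) (z g : M) (v a : 'rV[R]_n) (k : int) (i : nat).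

Lemma sinvariantB c S z g : sinvariant c S z -> sinvariant c S g -> sinvariant c S (z - g).
Proof. by move=> iz ig w wS; rewrite linearB /= iz ?ig. Qed.

Lemma sinvariantZ c S (r : F) z : sinvariant c S z -> sinvariant c S (r *: z).
Proof. by move=> iz w wS; rewrite linearZ /= iz. Qed.

Lemma sinvariantW c S S' z : (S <= S')%VS -> sinvariant c S' z -> sinvariant c S z.
Proof. by move=> SS' iz w wS; apply: iz; apply: (subvP SS'). Qed.

Lemma sigma_sinvariant c S a z : sinvariant c S z -> a \in S -> sigma c a z = q%:R *: z.
Proof.
move=> iz aS; rewrite /sigma (eq_bigr (fun=> z)) => [|t _]; last by rewrite iz ?memvZ.
by rewrite sumr_const scaler_nat.
Qed.

Lemma exists_col_eq1 v : v != 0 -> exists c : 'cV[R]_n, v *m c = 1%:M.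
Proof.
case/rV0Pn=> j vj; exists ((v 0 j)^-1 *: delta_mx j 0).
rewrite -scalemxAr -colE [col j v]mx11_scalar mxE scale_scalar_mx mulVf //.
Qed.

(* Averaging over a line of transvections makes a chain invariant under a     *)
(* larger subspace of them.  The lines of a plane reduce codimension at least *)
(* 2 to smaller codimension; in codimension 1 the average splits off.         *)
Lemma exact_sinvariant c u v0 k i : v0 \in u -> v0 *m c = 1%:M -> (0 < i < m)%N ->
  let w : T := (u :&: ker_col c)%VS in
  exact_at F m w k i.+1 -> exact_at F m w (k - 1) i.-1 ->
  (forall h : T, (\dim h).+1 = \dim w -> exact_at F m h (k - 1) i) ->
  forall S z, (S <= w)%VS -> supported u z -> homog k z -> sinvariant c S z ->
  bdX i z = 0 -> is_boundary m u k i z.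
Proof.
move=> v0u v0c im w exa exb exh S z Sw.
have wL : (w <= ker_col c)%VS by apply: capvSr.
have wu : (w <= u)%VS by apply: capvSl.
have [e] := ubnP (\dim w - \dim S); elim: e => // e IH in S z Sw * => le_e sz hz iz cyc.
have SL := subv_trans Sw wL.
have [wS|wS] := boolP (w <= S)%VS.
  by apply: (exact_invariant Hm q_neq0 v0u v0c im exa exb) => //; apply: sinvariantW iz.
have bd_sigma a g : a \in w -> a \notin S -> supported u g -> homog k g ->
    sinvariant c S g -> bdX i g = 0 -> is_boundary m u k i (sigma c a g).
  move=> aw aS sg hg ig cg; have [aL au] := (subvP wL _ aw, subvP wu _ aw).
  apply: (IH (S + <[a]>)%VS); first by rewrite subv_add Sw -memvE.
  - have := dim_addv_line aS; have : (\dim (S + <[a]>) <= \dim w)%N.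
      by apply: dimvS; rewrite subv_add Sw -memvE.
    by move=> le1 e1; move: le_e le1; rewrite e1; clear; lia.
  - exact: supported_sigma.
  - exact: homog_sigma.
  - exact: sinvariant_sigma.
  by rewrite bdX_sigma // cg linear0.
case/subvPn: (wS) => a aw aS; have aL := subvP wL _ aw.
have [wS'|/subvPn[b bw bS']] := boolP (w <= S + <[a]>)%VS.
  have wE : (S + <[a]>)%VS = w.
    by apply/eqP; rewrite eqEsubv wS' andbT subv_add Sw -memvE.
  have dimS : (\dim S).+1 = \dim w by rewrite -wE dim_addv_line.
  (* The normalised average is invariant under all of w, hence a boundary by induction, and [z - z0]
     is killed by [sigma c a]. *)
  pose z0 := q%:R^-1 *: sigma c a z.
  have au := subvP wu _ aw.
  have iz0 : sinvariant c (S + <[a]>)%VS z0.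
    by apply/sinvariantZ/sinvariant_sigma.
  rewrite -[z](subrK z0) addrC; apply: is_boundaryD; first by apply/is_boundaryZ/bd_sigma.
  apply: (exact_codim1 q_neq0 v0u v0c Sw aw aS dimS im (exh S dimS)).
  - by apply: supportedB => //; apply/supportedZ/supported_sigma.
  - by apply: homogB => //; apply/homogZ/homog_sigma.
  - by apply: sinvariantB => //; apply: sinvariantW iz0; apply: addvSl.
  - rewrite linearB /= (sigma_sinvariant iz0) ?memvE ?addvSr // scalerA mulfV //.
    by rewrite scale1r subrr.
  - by rewrite linearB linearZ /= bdX_sigma // cyc linear0 scaler0 subr0.
have bL := subvP wL _ bw; have bu := subvP wu _ bw.
have bS : b \notin S by apply: contra bS'; apply/subvP/addvSl.
have abS t : a + t *: b \notin S.
  have [->|t0] := eqVneq t 0; first by rewrite scale0r addr0.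
  apply: contra bS' => abS; have -> : b = t^-1 *: (a + t *: b - a).
    by rewrite [a + _]addrC addrK scalerA mulVf // scale1r.
  by rewrite memvZ // memvB // ?memvE ?addvSr // -memvE (subvP (addvSl _ _)).
(* This is [sigma_plane] solved for z; the directions [a + t *: b], b and a all lie outside S, so
   the induction hypothesis covers each sum. *)
have -> : z = q%:R^-1 *: (\sum_(t : R) sigma c (a + t *: b) z + (sigma c b z
            + (-1) *: sigma c a (sigma c b z))).
  by rewrite addrA sigma_plane // scaleN1r addrK scalerA mulVf // scale1r.
apply: is_boundaryZ; apply: is_boundaryD.
  by apply: is_boundary_sum => t; apply: bd_sigma => //; rewrite memvD ?memvZ.
apply: is_boundaryD; first exact: bd_sigma.
apply: is_boundaryZ; apply: bd_sigma => //.
- exact: supported_sigma.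
- exact: homog_sigma.
- by apply: sinvariantW (sinvariant_sigma SL bL iz); apply: addvSl.
by rewrite bdX_sigma // cyc linear0.
Qed.

(** The quantity 2k + m - i - dim u is the same for the three smaller instances that
    [exact_sinvariant] asks for, so the bounds are inherited. That lemma is used with S = 0, where
    invariance is void. *)
Theorem incidence_exact u k i : (i <= m)%N ->
  k *+ 2 + m%:Z - i%:Z <= (\dim u)%:Z \/ (\dim u)%:Z + m%:Z <= k *+ 2 + m%:Z - i%:Z ->
  exact_at F m u k i.
Proof.
have [d] := ubnP (\dim u); elim: d => // d IH in u k i * => le_d im ki z sz hz cyc.
have [i0|i0] := posnP i.
  move: cyc; rewrite i0 /bdX /= => ->; exists 0; rewrite linear0.
  by split=> // x _; rewrite ffunE.
have [mi|mi] := leqP m i.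
  have -> : i = m by lia.
  by exists z; rewrite addrK subnn; split.
(* In dimension 0 the bounds exclude k = 0, as 0 < i < m. *)
have [u0|u0] := posnP (\dim u).
  have -> : z = 0.
    apply/ffunP=> x; rewrite [RHS]ffunE.
    case: (boolP (x <= u)%VS) => [xu|/sz//]; apply: hz.
    by apply/eqP; have := dimvS xu; move: ki; rewrite u0; lia.
  by exists 0; rewrite linear0; split=> // x _; rewrite ffunE.
have v0 : vpick u != 0 by rewrite vpick0 -dimv_eq0 -lt0n.
have [c vc] := exists_col_eq1 v0; have vu := memv_pick u.
have dw : (\dim (u :&: ker_col c)).+1 = \dim u.
  by apply: hyperplane_ker_col; apply/subvPn; exists (vpick u); rewrite ?col1_notin.
have im' : (0 < i < m)%N by rewrite i0.
apply: (exact_sinvariant vu vc im' _ _ _ (sub0v _) sz hz _ cyc).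
- by apply: IH; move: dw; lia.
- by apply: IH; move: dw; lia.
- by move=> h dh; apply: IH; move: dh dw; lia.
- move=> w; rewrite memv0 => /eqP->; apply/ffunP=> x; rewrite ffunE shear0 //.
Qed.
End ExactAll.

(** * Characteristic polynomials in exact sequences *)

Section CharPoly.
Variable F : fieldType.

Lemma det_char_poly_mx_conj n (Q A B : 'M[F]_n) : Q \in unitmx -> Q *m A = B *m Q ->
  char_poly A = char_poly B.
Proof.
move=> Qu QA; pose Q' := map_mx polyC Q.
have Q'0 : \det Q' != 0.
  by rewrite det_map_mx polyC_eq0 -unitfE -[_ \is a _]/(Q \in unitmx).
apply: (mulfI Q'0); rewrite [RHS]mulrC -!det_mulmx; congr (\det _).
rewrite /char_poly_mx mulmxBr mulmxBl -!map_mxM QA /=; congr (_ - _).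
exact: scalar_mxC.
Qed.

Lemma char_poly_lblock n1 n2 (A : 'M[F]_n1) (B : 'M_(n2, n1)) (C : 'M_n2) :
  char_poly (block_mx A 0 B C) = char_poly A * char_poly C.
Proof.
rewrite /char_poly /char_poly_mx map_block_mx scalar_mx_block opp_block_mx add_block_mx.
by rewrite map_mx0 subr0 sub0r det_lblock.
Qed.

(* The hypotheses say that 0 -> F^n0 -> F^n -> F^n1 -> 0 is exact, and that   *)
(* its maps I and P intertwine A, B and C.                                    *)
Lemma char_poly_exact n0 n n1 (A : 'M[F]_n0) (B : 'M_n) (C : 'M_n1)
    (I : 'M_(n0, n)) (P : 'M_(n, n1)) :
    n = (n0 + n1)%N -> row_free I -> row_full P -> I *m P = 0 ->
    A *m I = I *m B -> B *m P = P *m C ->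
  char_poly B = char_poly A * char_poly C.
Proof.
move=> en; subst n => /row_freeP[I' II'] /row_fullP[J JP] IP AI BP.
(* The right inverse [I'] of I is corrected so that [J *m X = 0]; then [Q1] is the inverse of Q. *)
pose X := I' - P *m J *m I'; pose Q := col_mx I J; pose Q1 := row_mx X P.
have QQ1 : Q *m Q1 = 1%:M.
  rewrite mul_col_row !mulmxBr II' !mulmxA IP JP !mul0mx mul1mx subr0 subrr.
  by rewrite -scalar_mx_block.
have [Qu _] := mulmx1_unit QQ1.
have Q1Q : X *m I + P *m J = 1%:M by rewrite -mul_row_col (mulmx1C QQ1).
rewrite -(char_poly_lblock _ (J *m B *m X)).
apply: (det_char_poly_mx_conj Qu).
rewrite mul_col_mx mul_block_col mul0mx addr0 -AI; congr col_mx.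
rewrite -[LHS]mulmx1 -Q1Q mulmxDr !mulmxA; congr (_ + _).
by rewrite -[J *m B *m P]mulmxA BP mulmxA JP mul1mx.
Qed.

Lemma char_poly0 (A : 'M[F]_0) : char_poly A = 1.
Proof. exact: det_mx00. Qed.
End CharPoly.

(** * Additivity of lifted eigenvalue sums *)

Section RootSum.
Variables (K : closedFieldType) (V : zmodType) (theta : K -> V).

Definition root_sum (P : {poly K}) : V :=
  \sum_(z <- sval (closed_field_poly_normal P)) theta z.

Lemma root_sumE (s : seq K) :
  root_sum (\prod_(z <- s) ('X - z%:P)) = \sum_(z <- s) theta z.
Proof.
rewrite /root_sum; case: closed_field_poly_normal => r /= er; apply: perm_big.
apply: prod_XsubC_eq; move: er.
by rewrite (monicP (monic_prod_XsubC _ _ _)) scale1r => <-.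
Qed.

Lemma monic_prodE (P : {poly K}) : P \is monic ->
  exists s : seq K, P = \prod_(z <- s) ('X - z%:P).
Proof.
case: (closed_field_poly_normal P) => s eP /monicP P1; exists s.
by rewrite {1}eP P1 scale1r.
Qed.

Lemma root_sumM (P Q : {poly K}) : P \is monic -> Q \is monic ->
  root_sum (P * Q) = root_sum P + root_sum Q.
Proof.
move=> /monic_prodE[s ->] /monic_prodE[t ->].
by rewrite -big_cat !root_sumE big_cat.
Qed.

Lemma root_sum1 : root_sum 1 = 0.
Proof. by have := root_sumE [::]; rewrite !big_nil. Qed.
End RootSum.

Section Restriction.
Variables (F : fieldType) (K : closedFieldType) (iota : {rmorphism F -> K}).
Variables (V : zmodType) (theta : K -> V) (N : nat).
Implicit Types (U W f A : 'M[F]_N).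

Definition restr U A : 'M_(\rank U) := row_base U *m A *m pinvmx (row_base U).

Definition eig_sum d (A : 'M[F]_d) : V := root_sum theta (map_poly iota (char_poly A)).

Definition stable_mx A U := (U *m A <= U)%MS.

Lemma eig_sum_exact n0 n n1 (A : 'M[F]_n0) (B : 'M_n) (C : 'M_n1)
    (I : 'M_(n0, n)) (P : 'M_(n, n1)) :
    n = (n0 + n1)%N -> row_free I -> row_full P -> I *m P = 0 ->
    A *m I = I *m B -> B *m P = P *m C ->
  eig_sum B = eig_sum A + eig_sum C.
Proof.
move=> en fI fP IP AI BP; rewrite /eig_sum (char_poly_exact en fI fP IP AI BP).
by rewrite rmorphM root_sumM ?map_monic ?char_poly_monic.
Qed.

Lemma eig_sum0 (A : 'M[F]_0) : eig_sum A = 0.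
Proof. by rewrite /eig_sum char_poly0 rmorph1 root_sum1. Qed.

Lemma restrP U A : stable_mx A U -> row_base U *m A = restr U A *m row_base U.
Proof. by move=> sU; rewrite mulmxKpV // (eqmxMr _ (eq_row_base U)) eq_row_base. Qed.

(** Independence of the basis, as an exact sequence with zero quotient. *)
Lemma eig_sum_basis d U A (B : 'M_(d, N)) (C : 'M_d) : stable_mx A U ->
  row_free B -> (B :=: U)%MS -> B *m A = C *m B -> eig_sum (restr U A) = eig_sum C.
Proof.
move=> sU fB BU BA; pose I := row_base U *m pinvmx B.
have IB : I *m B = row_base U by rewrite mulmxKpV // BU eq_row_base.
have dU : d = \rank U by rewrite -BU; apply/esym/eqP.
have fI : row_free I.
  by rewrite -row_leq_rank; apply: (@leq_trans (\rank (row_base U)));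
    [rewrite eq_row_base|rewrite -IB mxrankM_maxl].
rewrite -[LHS]addr0 -(eig_sum0 0); apply/esym.
apply: (@eig_sum_exact _ _ _ (restr U A) C 0 I 0); rewrite ?addn0 ?mulmx0 //.
  by rewrite /row_full mxrank0.
by apply: (row_free_inj fB); rewrite -mulmxA IB -restrP // -mulmxA -BA mulmxA IB.
Qed.

Lemma eig_sum_restr_eqmx U W A : stable_mx A U -> (U :=: W)%MS ->
  eig_sum (restr U A) = eig_sum (restr W A).
Proof.
move=> sU UW; have sW : stable_mx A W by rewrite /stable_mx -(eqmxMr _ UW) -UW.
apply: (eig_sum_basis sU (row_base_free W) _ (restrP sW)).
by apply: eqmx_trans (eq_row_base W) _; apply: eqmx_sym.
Qed.

Lemma eig_sum_ker_img U f A : stable_mx A U -> A *m f = f *m A ->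
  eig_sum (restr U A) = eig_sum (restr (kermx f :&: U)%MS A) + eig_sum (restr (U *m f) A).
Proof.
move=> sU Af; set W := (kermx f :&: U)%MS.
have sUf : stable_mx A (U *m f) by rewrite /stable_mx -mulmxA -Af mulmxA submxMr.
have sW : stable_mx A W.
  rewrite /stable_mx sub_capmx (submx_trans _ sU) ?submxMr ?capmxSr // andbT.
  apply/sub_kermxP; rewrite -mulmxA Af mulmxA.
  by have /sub_kermxP -> := capmxSl (kermx f) U; rewrite mul0mx.
pose I := row_base W *m pinvmx (row_base U).
have IU : I *m row_base U = row_base W by rewrite mulmxKpV // !eq_row_base capmxSr.
pose P := row_base U *m f *m pinvmx (row_base (U *m f)).
have PU : P *m row_base (U *m f) = row_base U *m f.
  by rewrite mulmxKpV // eq_row_base (eqmxMr _ (eq_row_base U)).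
apply: (@eig_sum_exact _ _ _ _ _ _ I P).
- by rewrite -(mxrank_mul_ker U f) addnC capmxC.
- by rewrite -row_leq_rank; apply: (@leq_trans (\rank (row_base W)));
    [rewrite eq_row_base|rewrite -IU mxrankM_maxl].
- rewrite -col_leq_rank; apply: (@leq_trans (\rank (row_base U *m f))).
    by rewrite (eqmxMr f (eq_row_base U)).
  by rewrite -PU mxrankM_maxl.
- apply: (row_free_inj (row_base_free (U *m f))).
  rewrite -mulmxA PU mulmxA IU mul0mx; apply/sub_kermxP.
  by rewrite eq_row_base capmxSl.
- apply: (row_free_inj (row_base_free U)).
  by rewrite -mulmxA IU -restrP // -mulmxA -restrP // mulmxA IU.
apply: (row_free_inj (row_base_free (U *m f))).
rewrite -[LHS]mulmxA -[RHS]mulmxA PU -restrP // mulmxA -restrP // -mulmxA Af.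
by rewrite [RHS]mulmxA PU mulmxA.
Qed.

(** P sends a basis of W to the coordinates of its classes modulo U, in the basis that
    [section_repr] uses. *)
Lemma eig_sum_section (gT : finGroupType) (G : {group gT})
    (rG : mx_representation F G N) U W (modU : mxmodule rG U) (modW : mxmodule rG W) g :
  (U <= W)%MS -> g \in G ->
  eig_sum (restr W (rG g)) = eig_sum (restr U (rG g)) + eig_sum (section_repr modU modW g).
Proof.
move=> UW Gg.
have sU : stable_mx (rG g) U by apply: (mxmoduleP modU).
have sW : stable_mx (rG g) W by apply: (mxmoduleP modW).
pose X := (<<in_factmod U W>>)%MS.
have fE d (A : 'M[F]_(d, N)) : in_factmod U A = A *m col_base (cokermx U) by [].
have sE d (A : 'M_(d, _)) : in_submod X A = A *m (invmx (row_ebase X) *m pid_mx (\rank X)) by [].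
have RX : (in_factmod U (row_base W) <= X)%MS.
  by rewrite genmxE /in_factmod /= submxMr ?eq_row_base.
pose I := row_base U *m pinvmx (row_base W).
have IW : I *m row_base W = row_base U by rewrite mulmxKpV // !eq_row_base.
pose P := in_submod X (in_factmod U (row_base W)).
apply: (@eig_sum_exact _ _ _ _ _ _ I P).
- by rewrite genmxE addnC mxrank_in_factmod (addsmx_idPr UW).
- by rewrite -row_leq_rank; apply: (@leq_trans (\rank (row_base U)));
    [rewrite eq_row_base|rewrite -IW mxrankM_maxl].
- rewrite -col_leq_rank; apply: (@leq_trans (\rank (val_submod P))).
    by rewrite in_submodK // genmxE /in_factmod /= (eqmxMr _ (eq_row_base W)).
  exact: mxrankM_maxl.
- have -> : I *m P = in_submod X (in_factmod U (I *m row_base W)).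
    by rewrite /P ![in_submod _ _]sE !fE !mulmxA.
  rewrite IW; have /eqP -> : in_factmod U (row_base U) == 0.
    by rewrite in_factmod_eq0 eq_row_base.
  by rewrite sE mul0mx.
- apply: (row_free_inj (row_base_free W)).
  by rewrite -mulmxA IW -restrP // -mulmxA -restrP // mulmxA IW.
have -> : P *m section_repr modU modW g = in_submod X (in_factmod U (row_base W *m rG g)).
  by rewrite (in_factmodJ modU) // (in_submodJ (section_module modU modW)).
by rewrite restrP // /P ![in_submod _ _]sE !fE !mulmxA.
Qed.
End Restriction.

(** * Brauer characters of permutation modules *)

Section RootsOfUnity.
Variables (p : nat) (K : closedFieldType) (theta : K -> algC).
Hypotheses (Kp : p \in [pchar K]) (Htheta : brauer_lift p theta).

Lemma preg_root1_exp (l : nat) (z : K) : p^'.-nat l -> z ^+ l = 1 -> preg_root1 p z.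
Proof. by move=> pl zl; exists l; rewrite // unity_rootE zl. Qed.

(** The value is idempotent by multiplicativity, and nonzero as a root of unity. *)
Lemma theta1 : theta 1 = 1.
Proof.
have [thP thM _ _] := Htheta; have P1 : preg_root1 p (1 : K).
  by apply: (@preg_root1_exp 1); rewrite ?expr1n.
have := thM 1 1 P1 P1; rewrite mulr1 -[LHS]mulr1 => /esym/mulfI; apply.
have [r pr /unity_rootP t1] := thP _ P1; apply: contra_eq_neq t1 => /= ->.
by rewrite expr0n; case: r pr => //= r _; rewrite eq_sym oner_neq0.
Qed.

(* For l > 1 the l-th roots of unity are permuted by multiplication by one of *)
(* them, w <> 1, so their sum is fixed by multiplication by theta w <> 1.     *)
Lemma root_sum_Xn_sub_1 l : p^'.-nat l -> root_sum theta ('X^l - 1) = (l == 1%N)%:R.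
Proof.
move=> pl; have l0 : (0 < l)%N by case: l pl.
have [thP thM thI _] := Htheta.
have l0K : l%:R != 0 :> K.
  by rewrite -(dvdn_pcharf Kp) -p'natE // (pcharf_prime Kp).
have [s es] := monic_prodE (monic_Xn_sub_1 K l0).
have us : uniq s by rewrite -separable_prod_XsubC -es separable_Xn_sub_1.
have sizes : size s = l.
  by apply/eqP; rewrite -eqSS -(size_prod_XsubC s id) -es size_Xn_sub_1.
have mems z : (z \in s) = (z ^+ l == 1).
  by rewrite -root_prod_XsubC -es -unity_rootE.
have ps z : z \in s -> preg_root1 p z by rewrite mems => /eqP/(preg_root1_exp pl).
rewrite es root_sumE; case: eqP => [l1|/eqP l1].
  have : 1 \in s by rewrite mems expr1n.
  case: s sizes {es us mems ps} => [|z [|]]; rewrite l1 // => _.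
  by rewrite inE => /eqP <-; rewrite big_seq1 theta1.
have [w ws w1] : exists2 w, w \in s & w != 1.
  apply/hasP; apply: contraT; rewrite -all_predC => /allP s1.
  have : (size s <= size [:: 1%R : K])%N.
    by apply: uniq_leq_size => // z /s1 /=; rewrite negbK inE.
  by rewrite sizes /=; case: l l0 l1 {pl l0K es sizes mems} => [|[]].
have w0 : w != 0.
  by apply: contraTneq ws => ->; rewrite mems expr0n -(prednK l0) /= eq_sym oner_neq0.
have perm_w : perm_eq [seq w * z | z <- s] s.
  apply: uniq_perm => //; first by rewrite map_inj_uniq //; apply: mulfI.
  have sub : {subset [seq w * z | z <- s] <= s}.
    move=> _ /mapP[z zs ->]; move: ws zs; rewrite !mems exprMn => /eqP-> /eqP->.
    by rewrite mulr1.
  have uw : uniq [seq w * z | z <- s] by rewrite map_inj_uniq //; apply: mulfI.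
  by have [] := uniq_min_size uw sub; rewrite ?size_map.
have sumE : theta w * (\sum_(z <- s) theta z) = \sum_(z <- s) theta z.
  rewrite -[RHS](perm_big _ perm_w) big_map /= mulr_sumr; apply: eq_big_seq => z zs.
  by rewrite thM //; apply: ps.
apply/eqP; apply: contraNT w1 => s0; apply/eqP; apply: thI; first exact: ps.
  by apply: (@preg_root1_exp 1); rewrite ?expr1n.
by rewrite theta1; apply: (mulIf s0); rewrite mul1r.
Qed.
End RootsOfUnity.

Section PermutationModule.
Variables (F : fieldType) (T : finType) (s : T -> T).
Hypothesis s_inj : injective s.
Local Notation N := #|{: T}|.
Implicit Types (X Y : {set T}) (x : T).

Definition basis_vec x : 'rV[F]_N := delta_mx 0 (enum_rank x).

Lemma eq_basis_mx d (A B : 'M[F]_(N, d)) :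
  (forall x, basis_vec x *m A = basis_vec x *m B) -> A = B.
Proof.
move=> AB; apply/row_matrixP=> i; rewrite !rowE.
by have := AB (enum_val i); rewrite /basis_vec enum_valK.
Qed.

(** One matrix plays two roles: its row space is the span of X, and as an endomorphism it is the
    projection onto that span. *)
Definition set_mx X : 'M[F]_N :=
  \matrix_i (if enum_val i \in X then basis_vec (enum_val i) else 0).

Lemma basis_set_mx X x : basis_vec x *m set_mx X = if x \in X then basis_vec x else 0.
Proof. by rewrite -rowE rowK enum_rankK. Qed.

Lemma set_mxM X Y : set_mx X *m set_mx Y = set_mx (X :&: Y).
Proof.
apply: eq_basis_mx => x; rewrite mulmxA !basis_set_mx inE.
by case: ifP => _; rewrite ?mul0mx // basis_set_mx.
Qed.

Lemma set_mxD X Y : Y \subset X -> set_mx Y + set_mx (X :\: Y) = set_mx X.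
Proof.
move=> YX; apply: eq_basis_mx => x; rewrite mulmxDr !basis_set_mx inE.
case: (boolP (x \in Y)) => [/(subsetP YX) ->|_] /=; first by rewrite addr0.
by rewrite add0r.
Qed.

Lemma set_mx_sub d (B : 'M[F]_(d, N)) X :
  (forall x, x \in X -> (basis_vec x <= B)%MS) -> (set_mx X <= B)%MS.
Proof.
move=> XB; apply/row_subP=> i; rewrite rowK; case: ifP => [/XB //|_].
exact: sub0mx.
Qed.

Lemma basis_vec_sub x X : x \in X -> (basis_vec x <= set_mx X)%MS.
Proof. by move=> xX; have := basis_set_mx X x; rewrite xX => <-; apply: submxMl. Qed.

Lemma set_mx_ker X Y : Y \subset X ->
  (kermx (set_mx Y) :&: set_mx X :=: set_mx (X :\: Y))%MS.
Proof.
move=> YX; apply/eqmxP/andP; split; last first.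
  rewrite sub_capmx; apply/andP; split.
    apply/sub_kermxP/eq_basis_mx => x; rewrite mulmx0 mulmxA !basis_set_mx inE.
    by case: (boolP (x \in Y)) => [|/negbTE xY] /=; [|case: ifP => _];
      rewrite ?mul0mx // basis_set_mx xY.
  by apply: set_mx_sub => x; rewrite inE => /andP[_ /basis_vec_sub].
set W := (_ :&: _)%MS; have WX : W *m set_mx X = W.
  have /submxP[D WD] : (W <= set_mx X)%MS by apply: capmxSr.
  by rewrite [in LHS]WD -mulmxA set_mxM setIid -WD.
rewrite -WX -(set_mxD YX) mulmxDr.
have /sub_kermxP -> : (W <= kermx (set_mx Y))%MS by apply: capmxSl.
by rewrite add0r submxMl.
Qed.

Variable A : 'M[F]_N.
Hypothesis As : forall x, basis_vec x *m A = basis_vec (s x).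

Definition s_closed X := forall x, (s x \in X) = (x \in X).

Lemma set_mxC X : s_closed X -> A *m set_mx X = set_mx X *m A.
Proof.
move=> sX; apply: eq_basis_mx => x; rewrite !mulmxA As !basis_set_mx sX.
by case: ifP => _; rewrite ?As ?mul0mx.
Qed.

Lemma stable_set_mx X : s_closed X -> stable_mx A (set_mx X).
Proof. by move=> sX; rewrite /stable_mx -set_mxC // submxMl. Qed.

Definition orbit_set x := [set y | fconnect s x y].

Lemma orbit_set_closed x : s_closed (orbit_set x).
Proof. by move=> y; rewrite !inE -same_fconnect1_r. Qed.

Local Notation ord := fingraph.order.

Lemma iter_inj_ltn x i j : (i < ord s x)%N -> (j < ord s x)%N ->
  iter i s x = iter j s x -> i = j.
Proof. by move=> il jl e; rewrite -(findex_iter il) e findex_iter. Qed.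

Lemma order_dvd x l : iter l s x = x -> (ord s x %| l)%N.
Proof.
move=> sl; rewrite /dvdn; apply/eqP; apply: (@iter_inj_ltn x);
  rewrite ?ltn_mod ?fingraph.order_gt0 //.
rewrite -[in RHS]sl [in RHS](divn_eq l (ord s x)) addnC iterD /=.
congr iter; elim: (_ %/ _)%N => //= j IH; rewrite mulSn iterD -IH iter_order //.
Qed.

Section Orbit.
Variable x : T.
Local Notation l := (ord s x).
Local Notation P := ('X^l - 1 : {poly F}).

Let sizeP : (size P).-1 = l. Proof. by rewrite size_Xn_sub_1 ?fingraph.order_gt0. Qed.

Let ltn_order (k : 'I_(size P).-1) : (k < l)%N.
Proof. by apply: leq_trans (ltn_ord k) _; rewrite sizeP. Qed.

(** The number of rows equals l; it is written [(size P).-1] to match the type of the companion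
    matrix of P. *)
Definition orbit_mx : 'M[F]_((size P).-1, N) := \matrix_j basis_vec (iter j s x).

Lemma orbit_mx_free : row_free orbit_mx.
Proof.
apply/row_freeP; exists orbit_mx^T; apply/row_matrixP=> i; apply/rowP=> j.
rewrite !mxE (bigD1 (enum_rank (iter i s x))) //= !mxE !eqxx mul1r big1 => [|k kx].
  rewrite addr0; congr ((_ : bool)%:R); apply/eqP/eqP=> [/enum_rank_inj e|-> //].
  by apply/val_inj/(@iter_inj_ltn x); rewrite ?ltn_order.
by rewrite !mxE eqxx /= (negbTE kx) mul0r.
Qed.

Lemma orbit_mxE : (orbit_mx :=: set_mx (orbit_set x))%MS.
Proof.
apply/eqmxP/andP; split.
  apply/row_subP=> j; rewrite rowK basis_vec_sub // inE; apply: fconnect_iter.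
apply: set_mx_sub => y; rewrite inE => xy.
have ly : (findex s x y < (size P).-1)%N by rewrite sizeP findex_max.
have <- : row (Ordinal ly) orbit_mx = basis_vec y by rewrite rowK /= iter_findex.
exact: row_sub.
Qed.

Lemma orbit_mx_companion : orbit_mx *m A = companionmx P *m orbit_mx.
Proof.
apply/row_matrixP=> j; rewrite !row_mul rowK As -iterS.
have l0 : (0 < (size P).-1)%N by rewrite sizeP fingraph.order_gt0.
rewrite mulmx_sum_row.
have coefP (k : nat) : (k < l)%N -> P`_k = - (k == 0%N)%:R.
  by move=> kl; rewrite coefB coefXn coef1 (ltn_eqF kl) sub0r.
have jE : (j == (size P).-1.-1 :> nat) = (j.+1 == l).
  by move: (nat_of_ord j) => k; rewrite sizeP -eqSS prednK ?fingraph.order_gt0.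
have [jl|jl] := eqVneq (j.+1) l.
  rewrite jl iter_order // (bigD1 (Ordinal l0)) //= rowK big1 => [|k k0].
    by rewrite addr0 !mxE jE jl eqxx coefP ?fingraph.order_gt0 // opprK scale1r.
  rewrite !mxE jE jl eqxx coefP ?ltn_order //.
  by move: k0; rewrite -val_eqE /= => /negbTE->; rewrite oppr0 oppr0 scale0r.
have jl' : (j.+1 < (size P).-1)%N
  by apply: (@leq_trans l); [rewrite ltn_neqAle jl ltn_order|rewrite sizeP].
rewrite (bigD1 (Ordinal jl')) //= rowK big1 => [|k k0].
  by rewrite addr0 !mxE jE (negbTE jl) /= eqxx scale1r.
rewrite !mxE jE (negbTE jl); move: k0; rewrite -val_eqE /= eq_sym => /negbTE ->.
by rewrite scale0r.
Qed.
End Orbit.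
End PermutationModule.

Section PermutationCharacter.
Variables (p : nat) (F : fieldType) (K : closedFieldType) (iota : {rmorphism F -> K}).
Variable theta : K -> algC.
Hypotheses (Kp : p \in [pchar K]) (Htheta : brauer_lift p theta).
Variables (T : finType) (s : T -> T) (A : 'M[F]_#|{: T}|).
Hypotheses (s_inj : injective s) (As : forall x, basis_vec F x *m A = basis_vec F (s x)).
Hypothesis s_order : forall x, p^'.-nat (fingraph.order s x).
Local Notation S X := (eig_sum iota theta (restr (set_mx F X) A)).

Lemma eig_sum_orbit x : S (orbit_set s x) = (s x == x)%:R.
Proof.
rewrite (eig_sum_basis iota theta (stable_set_mx As (orbit_set_closed s_inj x))
  (orbit_mx_free F s x) (orbit_mxE F s x) (orbit_mx_companion s_inj As x)).
rewrite /eig_sum companionmxK ?monic_Xn_sub_1 ?fingraph.order_gt0 //.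
rewrite rmorphB rmorph1 /= map_polyXn (root_sum_Xn_sub_1 Kp Htheta) //.
congr ((_ : bool)%:R); apply/eqP/eqP => [l1|sx].
  by have := iter_order s_inj x; rewrite l1.
by apply/eqP; rewrite -dvdn1; apply: order_dvd.
Qed.

Lemma card_fixed_orbit x :
  #|[set y in orbit_set s x | s y == y]| = (s x == x).
Proof.
have fixE y : y \in orbit_set s x -> s y = y -> y = x.
  rewrite inE fconnect_sym // => /iter_findex <- sy.
  by elim: findex => //= j <-.
case: eqP => sx.
  rewrite (_ : [set _ in _ | _] = [set x]) ?cards1 //; apply/setP=> y.
  rewrite !inE; apply/andP/eqP=> [[xy /eqP sy]|->]; last by rewrite sx.
  by apply: fixE; rewrite ?inE.
apply/eqP; rewrite cards_eq0; apply/eqP/setP=> y; rewrite in_set0 in_set.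
by apply/negP=> /andP[xy /eqP sy]; case: sx; rewrite -(fixE y xy sy).
Qed.

(** Induction on the size of X, splitting off one orbit: it spans the kernel, within the span of X,
    of the projection onto its complement. *)
Lemma eig_sum_set X : s_closed s X -> S X = #|[set y in X | s y == y]|%:R.
Proof.
have [n] := ubnP #|X|; elim: n => // n IH in X * => leX sX.
have [->|[x xX]] := set_0Vmem X.
  rewrite (_ : [set _ in _ | _] = set0) ?cards0; last by apply/setP=> y; rewrite !inE.
  have r0 : \rank (set_mx F (set0 : {set T})) = 0%N.
    by apply/eqP; rewrite mxrank_eq0; apply/eqP/matrixP=> i j; rewrite !mxE inE mxE.
  by move: (restr _ _); rewrite r0 => B; apply: eig_sum0.
set O := orbit_set s x; have sO : s_closed s O by apply: orbit_set_closed.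
have OX : O \subset X.
  apply/subsetP=> y; rewrite inE => /iter_findex <-.
  by elim: findex => //= j; rewrite sX.
have sXO : s_closed s (X :\: O) by move=> y; rewrite !in_setD sX sO.
rewrite (eig_sum_ker_img iota theta (stable_set_mx As sX) (set_mxC As sXO)).
rewrite set_mxM (setIidPr (subsetDl X O)) IH //; last first.
  rewrite -ltnS (leq_trans _ leX) // ltnS proper_card // properE subsetDl /=.
  by apply/subsetPn; exists x => //; rewrite !inE connect0.
have kerE := set_mx_ker F (subsetDl X O); rewrite setDDr setDv finset.set0U (setIidPr OX) in kerE.
rewrite -(eig_sum_restr_eqmx iota theta (stable_set_mx As sO) (eqmx_sym kerE)).
rewrite eig_sum_orbit -card_fixed_orbit -/O -natrD; congr (_%:R).
rewrite -cardsUI [X in (_ + X)%N](_ : _ = 0%N) ?addn0.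
  apply: eq_card => y; rewrite !inE; case: (boolP (fconnect s x y)) => //= xy.
  by rewrite orbF (subsetP OX) // inE.
by apply/eqP; rewrite cards_eq0; apply/eqP/setP=> y; rewrite !inE; case: (fconnect _ _ _); rewrite ?andbF.
Qed.
End PermutationCharacter.

(** * From matrices to coordinate functions *)

Section IncidenceModules.
Variables (F : fieldType) (R : finFieldType) (n m : nat).
Hypothesis Hm : is_quantum_char F #|R| m.
Hypothesis q_neq0 : #|R|%:R != 0 :> F.
Local Notation T := (subspace R n).
Local Notation N := #|{: T}|.
Local Notation M := {ffun T -> F^o}.
Local Notation inc := (incidence_mx F R n).
Implicit Types (v : 'rV[F]_N) (k : int) (i : nat).

Lemma dim_full : \dim (fullv : T) = n.
Proof. by rewrite dimvf dim_matrix; apply: mul1n. Qed.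

Definition coords v : M := [ffun x : T => v 0 (enum_rank x)].
Definition of_coords (z : M) : 'rV[F]_N := \row_j z (enum_val j).

Lemma of_coordsK z : coords (of_coords z) = z.
Proof. by apply/ffunP=> x; rewrite ffunE mxE enum_rankK. Qed.

Lemma coords_inj : injective coords.
Proof.
move=> v w /ffunP vw; apply/rowP=> j; have := vw (enum_val j).
by rewrite !ffunE enum_valK.
Qed.

Lemma coords_incidence v : coords (v *m inc) = bd (coords v).
Proof.
apply/ffunP=> y; rewrite !ffunE mxE (reindex (@enum_rank T)) /=; last first.
  by exists enum_val => j _; rewrite ?enum_rankK ?enum_valK.
rewrite [RHS]big_mkcond; apply: eq_bigr => x _; rewrite !ffunE mxE enum_rankK.
rewrite summxE; case: ifP => [xy|xy].
  rewrite (bigD1 y) //= mxE !eqxx big1 ?addr0 ?mulr1 // => y' /andP[_ y'y].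
  by rewrite mxE eqxx /= (inj_eq enum_rank_inj) eq_sym (negbTE y'y).
rewrite big1 ?mulr0 // => y' y'x; rewrite mxE eqxx /= (inj_eq enum_rank_inj).
by case: eqP => // yy'; move: y'x xy; rewrite -yy' /covers => ->.
Qed.

Lemma coords_incidenceX i v : coords (v *m inc ^+ i) = bdX i (coords v).
Proof.
elim: i => [|i IH]; first by rewrite expr0 mulmx1.
by rewrite exprSr -mulmxE mulmxA coords_incidence IH.
Qed.

Definition dim_set k := [set x : T | (\dim x)%:Z == k].

Lemma degree_mxE k : (degree_mx F R n k :=: set_mx F (dim_set k))%MS.
Proof.
apply/eqmxP/andP; split.
  apply/sumsmx_subP=> x dx; rewrite genmxE.
  by apply: (@basis_vec_sub F T); rewrite inE.
apply: set_mx_sub => x; rewrite inE => dx.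
by rewrite (sumsmx_sup x) // genmxE.
Qed.

Lemma sub_degree_mx k v : (v <= degree_mx F R n k)%MS <-> homog k (coords v).
Proof.
have vE x : (v *m set_mx F (dim_set k)) 0 (enum_rank x)
    = if (\dim x)%:Z == k then v 0 (enum_rank x) else 0.
  rewrite mxE (bigD1 (enum_rank x)) //= !mxE enum_rankK inE big1 => [|j jx].
    by case: ifP; rewrite ?mxE ?eqxx ?mulr1 ?mulr0 addr0.
  rewrite mxE; case: ifP; rewrite mxE ?mulr0 // enum_valK eqxx /= eq_sym.
  by rewrite (negbTE jx) mulr0.
rewrite degree_mxE; split=> [/submxP[D vD] x xk|hv].
  rewrite ffunE (_ : v = v *m set_mx F (dim_set k)); last first.
    by rewrite vD -mulmxA set_mxM setIid.
  by rewrite vE (negbTE xk).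
suff -> : v = v *m set_mx F (dim_set k) by apply: submxMl.
apply/coords_inj/ffunP=> x; rewrite !ffunE vE; case: eqP => // /eqP xk.
by have := hv x xk; rewrite ffunE.
Qed.

Lemma incidenceX_m : inc ^+ m = 0.
Proof.
apply: (@eq_basis_mx F T) => x; apply: coords_inj; rewrite mulmx0.
by rewrite coords_incidenceX (bdX_m Hm); apply/ffunP=> y; rewrite !ffunE mxE.
Qed.

Lemma coords0 : coords 0 = 0.
Proof. by apply/ffunP=> x; rewrite !ffunE mxE. Qed.

Lemma boundaries_sub_cycles k i : (i <= m)%N ->
  (boundaries_mx F R n m k i <= cycles_mx F R n k i)%MS.
Proof.
move=> im; rewrite sub_capmx; apply/andP; split.
  by apply/sub_kermxP; rewrite -mulmxA mulmxE -exprD subnK // incidenceX_m mulr0.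
apply/rV_subP=> v /submxP[D ->]; rewrite mulmxA; apply/sub_degree_mx.
rewrite coords_incidenceX.
have ek : k + m%:Z - i%:Z - (m - i)%N%:Z = k by clear -im; lia.
rewrite -[X in homog X _]ek.
by apply: homog_bdX; apply/sub_degree_mx; apply: submxMl.
Qed.

Lemma cycles_sub_boundaries k i : (i <= m)%N ->
  k *+ 2 + m%:Z - i%:Z <= n%:Z \/ n%:Z + m%:Z <= k *+ 2 + m%:Z - i%:Z ->
  (cycles_mx F R n k i <= boundaries_mx F R n m k i)%MS.
Proof.
move=> im ki; apply/rV_subP=> v; rewrite sub_capmx => /andP[/sub_kermxP v0 /sub_degree_mx vk].
have [|x||z [_ hz ez]] := @incidence_exact R n F m Hm q_neq0 fullv k i im _ (coords v) _ vk.
- by rewrite dim_full.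
- by rewrite subvf.
- by rewrite -coords_incidenceX v0 coords0.
have -> : v = of_coords z *m inc ^+ (m - i).
  by apply: coords_inj; rewrite coords_incidenceX of_coordsK.
by rewrite submxMr //; apply/sub_degree_mx; rewrite of_coordsK.
Qed.
End IncidenceModules.

(** * Characters of cycles, boundaries and homology *)

Section LefschetzSum.
Variables (p : nat) (F : fieldType) (K : closedFieldType) (iota : {rmorphism F -> K}).
Variable theta : K -> algC.
Hypotheses (Fp : p \in [pchar F]) (Htheta : brauer_lift p theta).
Variables (R : finFieldType) (n m : nat).
Hypothesis Hm : is_quantum_char F #|R| m.
Hypothesis q_neq0 : #|R|%:R != 0 :> F.
Variable g : GLn R n.
Hypothesis Hg : (p^'.-elt g)%g.
Local Notation T := (subspace R n).
Local Notation A := (subspace_perm_mx F g).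
Local Notation chi U := (eig_sum iota theta (restr U A)).
Local Notation Z k i := (chi (cycles_mx F R n k i)).
Local Notation B k i := (chi (boundaries_mx F R n m k i)).

Let act (x : T) : T := subspace_act x g.

Let act_inj : injective act. Proof. exact: bij_inj (subspace_act_bij g). Qed.

Let act_A x : basis_vec F x *m A = basis_vec F (act x).
Proof. exact: subspace_vec_perm. Qed.

Let act_order x : p^'.-nat (fingraph.order act x).
Proof.
have dvd : (fingraph.order act x %| #[g]%g)%N.
  apply: order_dvd => //; have actX j : iter j act x = subspace_act x (g ^+ j)%g.
    elim: j => [|j IH]; first by rewrite expg0 subspace_act1.
    by rewrite iterS IH expgSr subspace_actM.
  by rewrite actX expg_order subspace_act1.
exact: pnat_dvd dvd Hg.
Qed.

Lemma eig_sum_degree k : chi (degree_mx F R n k) = (num_stable k g)%:R.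
Proof.
have cl : s_closed act (dim_set R n k) by move=> x; rewrite !inE dim_subspace_act.
rewrite -(eig_sum_restr_eqmx iota theta (stable_set_mx act_A cl) (eqmx_sym (degree_mxE F R n k))).
have Kp : p \in [pchar K] by rewrite (fmorph_pchar iota).
rewrite (eig_sum_set iota Kp Htheta act_inj act_A act_order cl); congr (_%:R).
by apply: eq_card => x; rewrite !inE.
Qed.

Lemma stableP U : mxmodule (subspace_repr F R n) U -> stable_mx A U.
Proof. by move/mxmoduleP/(_ g (in_setT g)). Qed.

(** Rank-nullity for the i-th power of the incidence map on M_k; its image is the boundary module of
    index (k - i, m - i), whose source degree is again k. *)
Lemma num_stableE k i : (i <= m)%N ->
  (num_stable k g)%:R = Z k i + B (k - i%:Z) (m - i)%N.
Proof.
move=> im; rewrite -eig_sum_degree.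
rewrite (eig_sum_ker_img iota theta (stableP (degree_module F R n k)) (esym (incidenceX_perm F i g))).
rewrite /boundaries_mx subKn //.
by have -> // : k - i%:Z + m%:Z - (m - i)%N%:Z = k by clear -im; lia.
Qed.

Lemma cycles_eq_boundaries k i : (i <= m)%N ->
  k *+ 2 + m%:Z - i%:Z <= n%:Z \/ n%:Z + m%:Z <= k *+ 2 + m%:Z - i%:Z -> Z k i = B k i.
Proof.
move=> im ki; apply: eig_sum_restr_eqmx; first exact/stableP/cycles_module.
by apply/eqmxP; rewrite boundaries_sub_cycles // cycles_sub_boundaries.
Qed.

Lemma boundaries_degree_out (k : int) i : (i <= m)%N -> k < 0 \/ n%:Z < k -> B k i = 0.
Proof.
move=> im kn; have d0 : degree_mx F R n k = 0.
  apply/eqP; rewrite -submx0 degree_mxE; apply: set_mx_sub => x; rewrite inE => /eqP dx.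
  by have := dimvS (subvf x); rewrite dim_full; clear -kn dx; lia.
have r0 : \rank (boundaries_mx F R n m k i) = 0%N.
  have := @boundaries_sub_cycles F R n m Hm k i im.
  by rewrite sub_capmx d0 submx0 => /andP[_ /eqP ->]; rewrite mxrank0.
by move: (restr _ _); rewrite r0 => C; apply: eig_sum0.
Qed.

Lemma brauer_char_homology k i : (i <= m)%N ->
  brauer_char iota theta (incidence_homology_repr F R n m k i) g = Z k i - B k i.
Proof.
move=> im; rewrite (@eig_sum_section F K iota _ theta _ _ _ (subspace_repr F R n) _ _
  (boundaries_module F R n m k i) (cycles_module F R n k i)) ?inE //; last first.
  exact: boundaries_sub_cycles.
by rewrite addrC addrA addNr add0r /eig_sum map_char_poly.
Qed.
End LefschetzSum.

(* Telescoping over the integers and the character formula *)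
From mathcomp Require Import classical_sets fsbigop.
Local Open Scope group_scope.
Local Open Scope classical_set_scope.
Local Open Scope ring_scope.

Lemma fsum_telescope (V : zmodType) (f b : int -> V) (c : V) (B : nat) :
    (forall t, f t = (if t == 0 then c else 0) + (b t - b (t - 1))) ->
    (forall t, t < - B%:Z \/ B%:Z < t -> b t = 0) ->
  \sum_(t \in [set: int]) f t = c.
Proof.
(* The window is [-(B+1), B+1], with B + B + 3 elements: the term at t = B + 1 can be nonzero
   through [b (t - 1)]. *)
move=> fE b0; pose tj (j : nat) : int := j%:Z - (B + 1)%N%:Z.
have tj_inj : injective tj by move=> i j /addIr [].
pose r := [seq tj j | j <- index_iota 0 (B + B + 3)].
have ur : uniq r by rewrite map_inj_uniq // iota_uniq.
rewrite (fsbigE r) //= => [|t _ tr]; last first.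
  have [tB tB'] : (t < - (B + 1)%N%:Z \/ (B + 1)%N%:Z < t) /\ t != 0.
    have bnd : ~ (- (B + 1)%N%:Z <= t <= (B + 1)%N%:Z).
      move=> /andP[t1 t2]; case/negP: tr; apply/mapP.
      by exists `|(t + (B + 1)%N%:Z)%R|%N; rewrite ?mem_index_iota /tj; lia.
    by split; lia.
  by rewrite fE (negbTE tB') add0r !b0 ?subrr //; lia.
rewrite big_map big_mkcond /=.
under eq_bigr => j _ do rewrite in_setT fE.
rewrite big_split -big_mkcond.
rewrite (eq_bigl (fun j => j == (B + 1)%N)); last by move=> j; rewrite subr_eq0.
rewrite big_nat1_eq ifT; last by lia.
rewrite (@telescope_sumr_eq _ 0 (B + B + 3) (fun j => b (tj j - 1))) //; last first.
  by move=> j _; congr (b _ - _); rewrite /tj; lia.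
rewrite !b0 /= ?subrr; [exact: addr0|by rewrite /tj; lia|by rewrite /tj; lia].
Qed.

Theorem theorem4p4 (Fq : finFieldType) (F : fieldType) (p : nat)
    (Fp : p \in [pchar F]) (pq : ~~ (p %| #|Fq|)%N)
    (m : nat) (Hm : is_quantum_char F #|Fq| m)
    (n : nat) (k : int) (i : nat) (Hki : middle_index n m k i)
    (K : closedFieldType) (iota : {rmorphism F -> K})
    (theta : K -> algC) (Htheta : brauer_lift p theta)
    (g : GLn Fq n) (Hg : p^'.-elt g) :
  brauer_char iota theta (incidence_homology_repr F Fq n m k i) g =
  \sum_(t \in [set: int])
    ((num_stable (k + t * m%:Z) g)%:R
       - (num_stable (k - i%:Z + t * m%:Z) g)%:R : algC).
Proof.
have q_neq0 : #|Fq|%:R != 0 :> F by rewrite -(dvdn_pcharf Fp).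
have [kn im mid] := Hki; have le_im : (i <= m)%N by case/andP: im => _ /ltnW.
have le_mi : (m - i <= m)%N by apply: leq_subr.
rewrite (brauer_char_homology iota theta Hm) //.
set Z := fun (k : int) (i : nat) => eig_sum iota theta (restr (cycles_mx F Fq n k i) (subspace_perm_mx F g)).
set B := fun (k : int) (i : nat) => eig_sum iota theta (restr (boundaries_mx F Fq n m k i) (subspace_perm_mx F g)).
have numE j l : (l <= m)%N -> (num_stable j g)%:R = Z j l + B (j - l%:Z) (m - l)%N.
  exact: (num_stableE iota Fp Htheta).
have ZB j l : (l <= m)%N -> j *+ 2 + m%:Z - l%:Z <= n%:Z \/
    n%:Z + m%:Z <= j *+ 2 + m%:Z - l%:Z -> Z j l = B j l.
  exact: (cycles_eq_boundaries iota theta Hm q_neq0).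
apply/esym; apply: (@fsum_telescope _ _ (fun t => B (k + t * m%:Z) i) _ n) => t.
  rewrite (numE _ i) // (numE (k - i%:Z + t * m%:Z) (m - i)%N) //.
  (* The index (k - i + tm, m - i) is never in the middle range: 2k - i + 2tm is below n for t <= 0
     and above n + m for t > 0. *)
  rewrite (ZB (k - i%:Z + t * m%:Z) (m - i)%N) //; last first.
    clear -mid le_im im; case: (leP t 0) => t0; [left|right]; nia.
  rewrite subKn // (_ : k + t * m%:Z - i%:Z = k - i%:Z + t * m%:Z); last by clear; lia.
  rewrite (_ : k - i%:Z + t * m%:Z - (m - i)%N%:Z = k + (t - 1) * m%:Z); last first.
    clear -le_im; lia.
  rewrite opprD addrA addrK; case: eqP => [->|t0].
    by rewrite mul0r addr0 addrA subrK.
  (* For nonzero t, the shift by 2tm moves 2k + m - i out of the open interval from n to n + m,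
     whose length is m. *)
  rewrite (ZB _ _ le_im) ?add0r //.
  clear -mid le_im im t0; case: (leP t 0) => ?; [left|right]; nia.
move=> tn; apply: (boundaries_degree_out iota theta Hm); first by [].
clear -kn im le_im tn; case: tn => tn; [left|right]; nia.
Qed.
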